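(* Let $\mathrm{L}$ be a relational $\omega$-signature, $\kappa$ a cardinal, and $\phi,\psi$ sentences of $\mathrm{L}_{\kappa\omega}$ with $\models_{\mathrm{Sh}}\phi\rightarrow\psi$. Then there is a sentence $\theta$ of $\mathrm{L}_{\kappa\omega}$ such that $\models_{\mathrm{Sh}}\phi\rightarrow\theta$, $\models_{\mathrm{Sh}}\theta\rightarrow\psi$, and every non-logical symbol appearing in $\theta$ appears both in $\phi$ and in $\psi$.
   Context: A relational $\omega$-signature consists of finitary relation symbols and constant symbols only. $\mathrm{L}_{\kappa\omega}$-formulae are built from atomic formulae by $\neg$, by conjunctions $\bigwedge\Phi$ and disjunctions $\bigvee\Phi$ of sets $\Phi$ of fewer than $\kappa$ formulae with jointly finitely many free variables, and by $\forall V,\exists V$ for finite sets $V$ of variables. For a complete Boolean algebra $\mathsf{B}$, a $\mathsf{B}$-valued model $\mathcal M$ for $\mathrm{L}$ is a nonempty set $M$ with maps $[\![\tau=\sigma]\!]\in\mathsf{B}$ and $[\![R(\bar\tau)]\!]\in\mathsf{B}$ and interpretations of constants in $M$, satisfying $[\![\tau=\tau]\!]=1$, symmetry, $[\![\tau=\sigma]\!]\wedge[\![\sigma=\pi]\!]\le[\![\tau=\pi]\!]$, and $\bigwedge_i[\![\tau_i=\sigma_i]\!]\wedge[\![R(\bar\tau)]\!]\le[\![R(\bar\sigma)]\!]$; values of formulae are defined recursively with $\neg$ as complement, $\bigwedge,\bigvee$ as infima/suprema, and $\forall,\exists$ as infima/suprema over assignments in $M$. $\mathcal M$ has the mixing property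 if for every antichain $A\subseteq\mathsf{B}$ and family $\{\tau_a:a\in A\}\subseteq M$ there is $\tau\in M$ with $a\le[\![\tau=\tau_a]\!]$ for all $a\in A$. $\models_{\mathrm{Sh}}\chi$ means $[\![\chi]\!]^{\mathcal M}=1_{\mathsf{B}}$ for every complete Boolean algebra $\mathsf{B}$ and every $\mathsf{B}$-valued model $\mathcal M$ (of a signature containing the symbols of $\chi$) with the mixing property. *)

(* Defs.v *)
From mathcomp Require Import all_boot all_order finmap.
From mathcomp Require Import boolp classical_sets cardinality.

Set Implicit Arguments.
Unset Strict Implicit.
Unset Printing Implicit Defensive.

Import Order.TTheory.

Local Open Scope classical_set_scope.
Local Open Scope card_scope.

(** * Syntax *)

Record signature := Signature {
  relsym : Type;
  arity : relsym -> nat;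
  cstsym : Type }.

Inductive term (L : signature) (X : choiceType) : Type :=
| Var of X
| Cst of cstsym L.

Arguments Var {L X} _.
Arguments Cst {L X} _.

(** The formulae of [L_{oo,omega}] with variables in [X].  A set of formulae
    is given as the range of a family indexed by a type [I]; the bound on the
    size of [I] and the finiteness of the joint free variables are imposed by
    [Lkw] below. *)
Inductive formula (L : signature) (X : choiceType) : Type :=
| Eq (s t : term L X)
| Rel (r : relsym L) (t : 'I_(arity r) -> term L X)
| Neg (phi : formula L X)
| Conj (I : Type) (Phi : I -> formula L X)
| Disj (I : Type) (Phi : I -> formula L X)
| All (V : {fset X}) (phi : formula L X)
| Ex (V : {fset X}) (phi : formula L X).

Arguments Rel {L X} r t.
Arguments Conj {L X I} Phi.
Arguments Disj {L X I} Phi.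

Definition Imp (L : signature) (X : choiceType) (phi psi : formula L X) :
    formula L X :=
  Disj (fun b : bool => if b then Neg phi else psi).

Definition term_vars (L : signature) (X : choiceType) (t : term L X) : set X :=
  match t with
  | Var x => [set x]
  | Cst _ => set0
  end.

Definition term_csts (L : signature) (X : choiceType) (t : term L X) :
    set (cstsym L) :=
  match t with
  | Var _ => set0
  | Cst c => [set c]
  end.

Fixpoint free_vars (L : signature) (X : choiceType) (phi : formula L X) :
    set X :=
  match phi with
  | Eq s t => term_vars s `|` term_vars t
  | Rel _ t => \bigcup_i term_vars (t i)
  | Neg phi => free_vars phi
  | Conj _ Phi | Disj _ Phi => \bigcup_i free_vars (Phi i)
  | All V phi | Ex V phi => free_vars phi `\` [set` V]
  end.

Fixpoint rel_syms (L : signature) (X : choiceType) (phi : formula L X) :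
    set (relsym L) :=
  match phi with
  | Eq _ _ => set0
  | Rel r _ => [set r]
  | Neg phi => rel_syms phi
  | Conj _ Phi | Disj _ Phi => \bigcup_i rel_syms (Phi i)
  | All _ phi | Ex _ phi => rel_syms phi
  end.

Fixpoint cst_syms (L : signature) (X : choiceType) (phi : formula L X) :
    set (cstsym L) :=
  match phi with
  | Eq s t => term_csts s `|` term_csts t
  | Rel _ t => \bigcup_i term_csts (t i)
  | Neg phi => cst_syms phi
  | Conj _ Phi | Disj _ Phi => \bigcup_i cst_syms (Phi i)
  | All _ phi | Ex _ phi => cst_syms phi
  end.

Definition card_lt (I K : Type) : Prop :=
  [set: I] #<= [set: K] /\ ~ ([set: K] #<= [set: I]).

(** [Lkw K phi]: [phi] is a formula of [L_{kappa,omega}], for [kappa] the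
    cardinality of [K]. *)
Fixpoint Lkw (K : Type) (L : signature) (X : choiceType) (phi : formula L X) :
    Prop :=
  match phi with
  | Eq _ _ | Rel _ _ => True
  | Neg phi | All _ phi | Ex _ phi => Lkw K phi
  | Conj J Phi | Disj J Phi =>
      [/\ card_lt J K, finite_set (\bigcup_i free_vars (Phi i))
        & forall i, Lkw K (Phi i)]
  end.

Definition sentence (K : Type) (L : signature) (X : choiceType)
    (phi : formula L X) : Prop :=
  Lkw K phi /\ free_vars phi = set0.

(** * Boolean-valued semantics *)

Local Open Scope order_scope.

Definition complete_lattice (d : Order.disp_t) (B : latticeType d) : Prop :=
  forall A : set B, supremums A !=set0 /\ infimums A !=set0.

(** Infima and suprema of sets, with the right value on the empty set; they
    are meaningful when [B] is complete. *)
Definition Inf (d : Order.disp_t) (B : tbLatticeType d) (A : set B) : B :=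
  infimum \top A.

Definition Sup (d : Order.disp_t) (B : tbLatticeType d) (A : set B) : B :=
  supremum \bot A.

Record bvmodel (L : signature) (d : Order.disp_t) (B : ctbDistrLatticeType d) :=
  BVModel {
    carrier :> Type;
    eqv : carrier -> carrier -> B;
    relv : forall r : relsym L, ('I_(arity r) -> carrier) -> B;
    cstv : cstsym L -> carrier;
    bv_nonempty : inhabited carrier;
    eqv_refl : forall s, eqv s s = \top;
    eqv_sym : forall s t, eqv s t = eqv t s;
    eqv_trans : forall s t u, eqv s t `&` eqv t u <= eqv s u;
    relv_congr : forall (r : relsym L) (s t : 'I_(arity r) -> carrier),
      (\meet_(i < arity r) eqv (s i) (t i)) `&` relv s <= relv t }.

Arguments relv {L d B} _ r _.

Definition term_value (L : signature) (X : choiceType) (d : Order.disp_t)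
    (B : ctbDistrLatticeType d) (M : bvmodel L B) (t : term L X) (e : X -> M) :
    M :=
  match t with
  | Var x => e x
  | Cst c => cstv M c
  end.

Definition reassign (X : choiceType) (M : Type) (V : {fset X}) (e : X -> M) :
    set (X -> M) :=
  [set e' : X -> M | forall x, x \notin V -> e' x = e x].

Fixpoint value (L : signature) (X : choiceType) (d : Order.disp_t)
    (B : ctbDistrLatticeType d) (M : bvmodel L B) (phi : formula L X)
    (e : X -> M) : B :=
  match phi with
  | Eq s t => eqv (term_value s e) (term_value t e)
  | Rel r t => relv M r (fun i => term_value (t i) e)
  | Neg phi => ~` value phi e
  | Conj _ Phi => Inf (range (fun i => value (Phi i) e))
  | Disj _ Phi => Sup (range (fun i => value (Phi i) e))
  | All V phi =>
      Inf [set value phi e' | e' in reassign V e]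
  | Ex V phi =>
      Sup [set value phi e' | e' in reassign V e]
  end.

(** Antichains in the sense of forcing: pairwise incompatible elements. *)
Definition incompatible_family (d : Order.disp_t) (B : ctbDistrLatticeType d)
    (A : set B) : Prop :=
  forall a b, A a -> A b -> a <> b -> a `&` b = \bot.

(** As the carrier is nonempty, families indexed by [A] extend to [B]. *)
Definition mixing (L : signature) (d : Order.disp_t)
    (B : ctbDistrLatticeType d) (M : bvmodel L B) : Prop :=
  forall (A : set B) (t : B -> M), incompatible_family A ->
    exists u : M, forall a, A a -> a <= eqv u (t a).

Definition Sh_valid (L : signature) (X : choiceType) (chi : formula L X) :
    Prop :=
  forall (d : Order.disp_t) (B : ctbDistrLatticeType d) (M : bvmodel L B),
    complete_lattice B -> mixing M -> forall e : X -> M, value chi e = \top.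

(* Main.v *)
From HB Require Import structures.
Require Import Defs.
From mathcomp Require Import all_boot all_order finmap.
From mathcomp Require Import boolp classical_sets functions cardinality.

Set Implicit Arguments.
Unset Strict Implicit.
Unset Printing Implicit Defensive.

Import Order.Theory.

Local Open Scope classical_set_scope.
Local Open Scope card_scope.

(** Suppose first that [K] has at least three elements.  Conditions are pairs
    (left, right) of sets of formulae, with finitely many free variables
    jointly, that no formula in the common language separates: none is entailed
    by the left part while its negation is entailed by the right part.  If
    ([phi], [Neg psi]) is separated, the separating formula is an interpolant.
    Otherwise the regular sets of conditions, ordered by inclusion, form a
    complete Boolean algebra, over which the names for variables form a mixing
    model: an atom is forced when it is densely entailed by one of the sides.
    Inseparability is preserved by splitting disjunctions, by adding fresh
    witnesses and by transferring common formulae to the other side, so every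
    formula entailed by a side in its own language is forced.  In particular
    the value of [Imp phi psi] in this model is not [\top].

    If [K] has at most two elements, binary connectives are not available, but
    every formula is a prefix of negations and quantifiers before an atom.
    When [phi] has a relation symbol that [psi] lacks, reinterpreting it by a
    constant makes [phi] true, whence [psi] is valid.  Otherwise one replaces
    the constants of [phi] that [psi] lacks by existentially quantified
    variables. *)

(** * The complete Boolean algebra of regular sets of a forcing notion *)

Record forcing := Forcing {
  cond :> Type;
  ext : cond -> cond -> Prop;
  ext_refl : forall p, ext p p;
  ext_trans : forall p q r, ext r q -> ext q p -> ext r p }.

Section Regular.
Variable P : forcing.

Definition dense_below (p : P) (U : set P) : Prop :=
  forall q, ext q p -> exists2 r, ext r q & U r.

(** These are the regular open sets for the topology whose open sets are the sets closed under
    extension. The single equivalence [rsetP] also yields that closure, see [rset_ext]. *)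
Record regular := Regular {
  rset :> P -> Prop;
  rsetP : forall p, rset p <-> dense_below p rset }.

Lemma rset_ext (U : regular) p q : ext q p -> U p -> U q.
Proof.
move=> qp /rsetP Up; apply/rsetP => r rq.
by apply: Up; apply: ext_trans qp.
Qed.

Lemma regular_inj (U V : regular) : (forall p, U p <-> V p) -> U = V.
Proof.
case: U V => U hU [V hV] /= UV.
have e : U = V by rewrite predeqE.
by subst V; congr Regular; apply: Prop_irrelevance.
Qed.

Definition downward (U : set P) := forall p q, ext q p -> U p -> U q.

Lemma dense_below_mono p q U : ext q p -> dense_below p U -> dense_below q U.
Proof. by move=> qp h r rq; apply: h; apply: ext_trans qp. Qed.

Lemma dense_belowS p (U V : set P) :
  U `<=` V -> dense_below p U -> dense_below p V.
Proof. by move=> UV h q /h[r rq /UV Vr]; exists r. Qed.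

Lemma dense_below_idem p U :
  dense_below p (dense_below^~ U) -> dense_below p U.
Proof.
move=> h q /h[r rq /(_ r (ext_refl r))[s sr Us]].
by exists s => //; apply: ext_trans rq.
Qed.

Lemma dense_below_down U p : downward U -> U p -> dense_below p U.
Proof. by move=> dU Up q qp; exists q; [exact: ext_refl|exact: dU Up]. Qed.

Lemma closureP (U : set P) p :
  dense_below p U <-> dense_below p (dense_below^~ U).
Proof.
split; last exact: dense_below_idem.
move=> h q qp; exists q; first exact: ext_refl.
exact: dense_below_mono h.
Qed.

(** This is the interior of the closure of [U]. It need not contain [U] unless [U] is downward
    closed, see [dense_below_down]. *)
Definition rcl (U : set P) : regular := Regular (closureP U).

Lemma rmeetP (U V : set P) (hU : forall p, U p <-> dense_below p U)
    (hV : forall p, V p <-> dense_below p V) p :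
  (U `&` V) p <-> dense_below p (U `&` V).
Proof.
split=> [[/hU Up /hV Vp]|h].
- move=> q qp; exists q; first exact: ext_refl.
  by split; [apply/hU|apply/hV]; exact: dense_below_mono qp _.
- by split; [apply/hU|apply/hV]; apply: dense_belowS h => x [].
Qed.

Definition rmeet (U V : regular) := Regular (rmeetP (@rsetP U) (@rsetP V)).

Definition rcompl_set (U : regular) : set P :=
  fun p => forall q, ext q p -> ~ U q.

Lemma rcomplP (U : regular) p :
  rcompl_set U p <-> dense_below p (rcompl_set U).
Proof.
split=> [h q qp|h q qp Uq].
- exists q; first exact: ext_refl.
  by move=> r rq; apply: h; apply: ext_trans qp.
- have [r rq /(_ r (ext_refl r))] := h q qp.
  by apply; exact: rset_ext Uq.
Qed.

Definition rcompl (U : regular) : regular := Regular (@rcomplP U).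
Definition rjoin (U V : regular) : regular := rcl (U `|` V).
Definition rbot : regular := rcl set0.
Definition rtop : regular := rcl setT.

Definition rle (U V : regular) : bool := `[< U `<=` V >].

HB.instance Definition _ := gen_eqMixin regular.
HB.instance Definition _ := gen_choiceMixin regular.

Fact regular_display : Order.disp_t. Proof. exact: Order.Disp tt tt. Qed.

Lemma rle_refl : reflexive rle.
Proof. by move=> U; apply/asboolP. Qed.

Lemma rle_anti : antisymmetric rle.
Proof.
move=> U V /andP[/asboolP UV /asboolP VU]; apply: regular_inj => p.
by split=> [/UV|/VU].
Qed.

Lemma rle_trans : transitive rle.
Proof.
by move=> V U W /asboolP UV /asboolP VW; apply/asboolP => p /UV /VW.
Qed.

HB.instance Definition _ :=
  Order.Le_isPOrder.Build regular_display regular rle_refl rle_anti rle_trans.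

Lemma rmeet_glb (U V W : regular) : rle U (rmeet V W) = rle U V && rle U W.
Proof.
apply/idP/idP => [/asboolP h|/andP[/asboolP UV /asboolP UW]].
- by apply/andP; split; apply/asboolP => p /h[].
- by apply/asboolP => p Up; split; [exact: UV|exact: UW].
Qed.

Lemma rjoin_lub (U V W : regular) : rle (rjoin U V) W = rle U W && rle V W.
Proof.
apply/idP/idP => [/asboolP h|/andP[/asboolP UW /asboolP VW]].
- apply/andP; split; apply/asboolP => p Up; apply: h => q qp.
  + by exists q; [exact: ext_refl|left; exact: rset_ext Up].
  + by exists q; [exact: ext_refl|right; exact: rset_ext Up].
- apply/asboolP => p h; apply/rsetP; apply: dense_belowS h => q.
  by case=> [/UW|/VW].
Qed.

HB.instance Definition _ := Order.POrder_MeetJoin_isLattice.Build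
  regular_display regular rmeet_glb rjoin_lub.

Lemma rmeetUl : @left_distributive regular regular rmeet rjoin.
Proof.
move=> U V W; apply: regular_inj => p; split=> [[h Wp] q qp|h].
- have [r rq [Ur|Vr]] := h q qp; exists r => //.
  + by left; split=> //; apply: rset_ext Wp; apply: ext_trans qp.
  + by right; split=> //; apply: rset_ext Wp; apply: ext_trans qp.
- split; first by apply: dense_belowS h => q [[]|[]]; [left|right].
  by apply/rsetP; apply: dense_belowS h => q [[]|[]].
Qed.

HB.instance Definition _ := Order.Lattice_Meet_isDistrLattice.Build
  regular_display regular rmeetUl.

Lemma rbot_le U : rle rbot U.
Proof.
by apply/asboolP => p /(_ p (ext_refl p))[].
Qed.

Lemma rle_top U : rle U rtop.
Proof. by apply/asboolP => p _ q _; exists q => //; exact: ext_refl. Qed.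

HB.instance Definition _ :=
  Order.hasBottom.Build regular_display regular rbot_le.
HB.instance Definition _ :=
  Order.hasTop.Build regular_display regular rle_top.

Lemma rjoinxC (U : regular) : rjoin U (rcompl U) = rtop.
Proof.
apply: regular_inj => p; split=> [_ q _|_ q _].
  by exists q; [exact: ext_refl|].
have [[r rq Ur]|h] := pselect (exists2 r, ext r q & U r).
  by exists r => //; left.
exists q; first exact: ext_refl.
by right=> r rq Ur; apply: h; exists r.
Qed.

Lemma rmeetxC (U : regular) : rmeet U (rcompl U) = rbot.
Proof.
apply: regular_inj => p; split=> [[Up /(_ p (ext_refl p))]//|h].
by have [] := h p (ext_refl p).
Qed.

HB.instance Definition _ := Order.TBDistrLattice_hasComplement.Build
  regular_display regular rjoinxC rmeetxC.
End Regular.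

Section RegularTheory.
Variable P : forcing.
Implicit Types (U V : regular P) (p q r : P).
Local Open Scope order_scope.

Lemma regular_leP U V : reflect (rset U `<=` V) (U <= V).
Proof. exact: asboolP. Qed.

Lemma mem_rtop p : (\top : regular P) p.
Proof. by move=> q _; exists q => //; exact: ext_refl. Qed.

Lemma mem_rbot p : ~ (\bot : regular P) p.
Proof. by move/(_ p (ext_refl p)) => []. Qed.

Lemma mem_rcompl U p : (~` U : regular P) p <-> forall q, ext q p -> ~ U q.
Proof. by []. Qed.

Lemma mem_rbigmeet (I : finType) (F : I -> regular P) p :
  (\meet_i F i) p <-> forall i, F i p.
Proof.
split=> [h i|h].
  by move/regular_leP: (@meets_inf _ _ _ i xpredT F isT); apply.
elim/big_ind: _ => [|U V Up Vp|i _]; [exact: mem_rtop|by []|exact: h].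
Qed.

Lemma bigcap_regularP (A : set (regular P)) p :
  (\bigcap_(U in A) rset U) p <->
  dense_below p (\bigcap_(U in A) rset U).
Proof.
split=> [h q qp|h U AU].
- exists q; first exact: ext_refl.
  by move=> U AU; apply: rset_ext (h U AU).
- by apply/rsetP; apply: dense_belowS h => q; apply.
Qed.

Definition rinf (A : set (regular P)) := Regular (bigcap_regularP A).
Definition rsup (A : set (regular P)) := rcl (\bigcup_(U in A) rset U).

Lemma rinf_infimums A : infimums A (rinf A).
Proof.
split=> [U AU|U lU]; apply/regular_leP => p; first by apply.
by move=> Up V AV; move/regular_leP: (lU V AV); apply.
Qed.

Lemma rsup_supremums A : supremums A (rsup A).
Proof.
split=> [U AU|U lU]; apply/regular_leP => p.
- move=> Up q qp; exists q; first exact: ext_refl.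
  by exists U => //; apply: rset_ext Up.
- move=> h; apply/rsetP; apply: dense_belowS h => q [V AV].
  by move/regular_leP: (lU V AV); apply.
Qed.

Lemma regular_complete : complete_lattice (regular P).
Proof.
by move=> A; split; [exists (rsup A); exact: rsup_supremums|
  exists (rinf A); exact: rinf_infimums].
Qed.
End RegularTheory.

(** * Suprema and infima in complete Boolean algebras *)

Section CompleteLattice.
Local Open Scope order_scope.
Variables (d : Order.disp_t) (B : ctbDistrLatticeType d).
Hypothesis hB : complete_lattice B.
Implicit Types (A : set B) (a b c : B).

Lemma Sup_supremums A : supremums A (Sup A).
Proof.
have [[x sx] _] := hB A; rewrite /Sup /supremum.
case: ifPn => [/eqP A0|_]; last by case: xgetP => // /(_ x)/(_ sx).
by split=> [a|b _]; [rewrite A0|exact: le0x].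
Qed.

Lemma Inf_infimums A : infimums A (Inf A).
Proof.
have [_ [x sx]] := hB A; rewrite /Inf /infimum.
case: ifPn => [/eqP A0|_]; last by case: xgetP => // /(_ x)/(_ sx).
by split=> [a|b _]; [rewrite A0|exact: lex1].
Qed.

Lemma le_Sup A a : A a -> a <= Sup A.
Proof. by case: (Sup_supremums A) => h _ /h. Qed.

Lemma Inf_le A a : A a -> Inf A <= a.
Proof. by case: (Inf_infimums A) => h _ /h. Qed.

Lemma Sup_le A b : (forall a, A a -> a <= b) -> Sup A <= b.
Proof. by case: (Sup_supremums A) => _ h lb; apply: h. Qed.

Lemma le_Inf A b : (forall a, A a -> b <= a) -> b <= Inf A.
Proof. by case: (Inf_infimums A) => _ h lb; apply: h. Qed.

Lemma le_implE a b c : (a `&` b <= c) = (b <= ~` a `|` c).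
Proof.
apply/idP/idP => h.
- rewrite -[b]meet1x -(joinxC a) joinC meetUl; apply: leU2 => //.
  exact: leIl.
- apply: le_trans (leI2 (lexx a) h) _.
  by rewrite meetUr meetxC join0x leIr.
Qed.

(** This is infinite distributivity in the form of an elimination rule. By [le_implE] each [a] in
    [A] lies below the implication from [b] to [c], hence so does [Sup A], and hence [b] itself. *)
Lemma le_Sup_elim A b c :
  b <= Sup A -> (forall a, A a -> b `&` a <= c) -> b <= c.
Proof.
move=> bA h; rewrite -(meetxx b) le_implE (le_trans bA)//.
by apply: Sup_le => a Aa; rewrite -le_implE h.
Qed.
End CompleteLattice.

Section RegularSup.
Variable P : forcing.
Local Open Scope order_scope.
Implicit Types (A : set (regular P)) (p : P).

(** [Sup] is only known as some least upper bound, so it is compared with the explicit one,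
    [rsup A]. *)
Lemma mem_Sup A p : Sup A p <-> dense_below p (\bigcup_(U in A) rset U).
Proof.
split=> h.
- have /regular_leP := Sup_le (@regular_complete P) (rsup_supremums A).1.
  by apply.
- apply/rsetP; apply: dense_belowS h => q [U AU Uq].
  by have /regular_leP := le_Sup (@regular_complete P) AU; apply.
Qed.

Lemma mem_Inf A p : Inf A p <-> forall U, A U -> U p.
Proof.
split=> [h U AU|h].
- by have /regular_leP := Inf_le (@regular_complete P) AU; apply.
- have /regular_leP := le_Inf (@regular_complete P) (rinf_infimums A).1.
  by apply.
Qed.
End RegularSup.

(** * Dependence of values on assignments, renamed formulae and entailment *)

Section Semantics.
Local Open Scope order_scope.
Variables (L : signature) (X : choiceType).
Implicit Types (chi : formula L X).

Section Model.
Variables (d : Order.disp_t) (B : ctbDistrLatticeType d) (M : bvmodel L B).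
Implicit Types (e : X -> M) (t : term L X).

Lemma term_value_ext t e e' :
  (forall x, term_vars t x -> e x = e' x) -> term_value t e = term_value t e'.
Proof. by case: t => //= x; apply. Qed.

Lemma reassign_ext (V : {fset X}) (A : set X) e1 e2 (F : (X -> M) -> B) :
  (forall x, (A `\` [set` V])%classic x -> e1 x = e2 x) ->
  (forall e e', (forall x, A x -> e x = e' x) -> F e = F e') ->
  [set F e | e in reassign V e1] `<=` [set F e | e in reassign V e2].
Proof.
move=> e12 Fext _ [e h <-].
(* The new values are kept on [V] and those of [e2] restored elsewhere; [F] looks only at [A], where
   the result agrees with [e]. *)
exists (fun x => if x \in V then e x else e2 x).
  by move=> x; case: (x \in V).
apply: Fext => x Ax; case: ifPn => // xV.
by rewrite h// e12//; split=> //; apply/negP.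
Qed.

Lemma value_ext chi e e' :
  (forall x, free_vars chi x -> e x = e' x) -> value chi e = value chi e'.
Proof.
elim: chi e e' => [s t|r t|phi IH|I Phi IH|I Phi IH|V phi IH|V phi IH]
  e e' h /=.
- by congr eqv; apply: term_value_ext => x tx; apply: h; [left|right].
- congr (relv M r _); apply/funext => i; apply: term_value_ext => x tx.
  by apply: h; exists i.
- by rewrite (IH e e').
- have -> // : (fun i => value (Phi i) e) = (fun i => value (Phi i) e').
  by apply/funext => i; apply: IH => x fx; apply: h; exists i.
- have -> // : (fun i => value (Phi i) e) = (fun i => value (Phi i) e').
  by apply/funext => i; apply: IH => x fx; apply: h; exists i.
- congr Inf; apply/seteqP; split.
  + exact: reassign_ext h IH.
  + by apply: reassign_ext IH => x fx; rewrite (h x fx).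
- congr Sup; apply/seteqP; split.
  + exact: reassign_ext h IH.
  + by apply: reassign_ext IH => x fx; rewrite (h x fx).
Qed.

Hypothesis hB : complete_lattice B.

Lemma term_value_congr t e e' b : (forall x, b <= eqv (e x) (e' x)) ->
  b <= eqv (term_value t e) (term_value t e').
Proof. by move=> h; case: t => [x|c] //=; rewrite eqv_refl lex1. Qed.

Lemma reassign_congr (V : {fset X}) e e' e1 b :
  (forall x, b <= eqv (e x) (e' x)) -> reassign V e e1 ->
  exists2 e1', reassign V e' e1' & forall x, b <= eqv (e1 x) (e1' x).
Proof.
move=> h h1; exists (fun x => if x \in V then e1 x else e' x) => [x|x].
  by move/negbTE => ->.
by case: ifPn => [_|xV]; [rewrite eqv_refl lex1|rewrite h1].
Qed.

(** The induction keeps [b] fixed and lets the assignments vary: negation exchanges them by symmetry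
    of equality, and [reassign_congr] carries a reassignment of one over to the other. *)
Lemma value_congr chi e e' b : (forall x, b <= eqv (e x) (e' x)) ->
  b `&` value chi e <= value chi e'.
Proof.
elim: chi e e' => [s t|r t|phi IH|I Phi IH|I Phi IH|V phi IH|V phi IH]
  e e' h /=.
- have hs := term_value_congr s h; have ht := term_value_congr t h.
  apply: le_trans (eqv_trans _ (term_value t e) _); rewrite lexI.
  apply/andP; split; last by rewrite (le_trans (leIl _ _)).
  apply: le_trans (eqv_trans _ (term_value s e) _); rewrite lexI leIr andbT.
  by rewrite [X in _ <= X]eqv_sym (le_trans (leIl _ _)).
- apply: le_trans (relv_congr _ _); apply: leI2 (lexx _).
  by apply/meetsP => i _; apply: term_value_congr.
- rewrite -disj_leC -lex0 -(meetCx (value phi e)) -meetA [X in X <= _]meetCA.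
  by rewrite leI2// IH// => x; rewrite eqv_sym.
- apply: le_Inf => // _ [i _ <-]; apply: le_trans (IH i _ _ h).
  by apply: leI2 => //; apply: Inf_le => //; exists i.
- rewrite le_implE; apply: Sup_le => // _ [i _ <-].
  rewrite -le_implE; apply: le_trans (IH i _ _ h) _.
  by apply: le_Sup => //; exists i.
- apply: le_Inf => // _ [e1 h1 <-].
  have h' x : b <= eqv (e' x) (e x) by rewrite eqv_sym.
  have [e2 h2 h12] := reassign_congr h' h1.
  apply: le_trans (IH e2 e1 _); last by move=> x; rewrite eqv_sym.
  by apply: leI2 => //; apply: Inf_le => //; exists e2.
- rewrite le_implE; apply: Sup_le => // _ [e1 h1 <-].
  rewrite -le_implE.
  have [e2 h2 h12] := reassign_congr h h1.
  apply: le_trans (IH e1 e2 h12) _.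
  by apply: le_Sup => //; exists e2.
Qed.
End Model.

Definition term_subst (sg : X -> X) (t : term L X) : term L X :=
  if t is Var x then Var (sg x) else t.

Lemma term_substE sg t d (B : ctbDistrLatticeType d) (M : bvmodel L B)
  (e : X -> M) : term_value (term_subst sg t) e = term_value t (e \o sg).
Proof. by case: t. Qed.

Lemma finite_term_vars (t : term L X) : finite_set (term_vars t).
Proof. by case: t => [x|c] /=; [exact: finite_set1|exact: finite_set0]. Qed.

Lemma Lkw_finite K chi : Lkw K chi -> finite_set (free_vars chi).
Proof.
elim: chi => [s t|r t|phi IH|I Phi IH|I Phi IH|V phi IH|V phi IH] //=.
- by move=> _; rewrite finite_setU; split; exact: finite_term_vars.
- move=> _; apply: bigcup_finite => [|i _]; last exact: finite_term_vars.
  exact: finite_finset.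
- by case.
- by case.
- by move=> /IH; apply: finite_setD.
- by move=> /IH; apply: finite_setD.
Qed.

(* Renaming replaces capture-avoiding substitution: a pair [(chi, sg)] stands
   for [chi] with its free variables renamed by [sg]. *)
Definition rformula : Type := formula L X * (X -> X).

Definition cval d (B : ctbDistrLatticeType d) (M : bvmodel L B) (c : rformula)
    (e : X -> M) : B := value c.1 (e \o c.2).

Definition cvars (c : rformula) : set X := c.2 @` free_vars c.1.

Lemma cval_ext d (B : ctbDistrLatticeType d) (M : bvmodel L B) c
    (e e' : X -> M) :
  (forall x, cvars c x -> e x = e' x) -> cval c e = cval c e'.
Proof. by move=> h; apply: value_ext => x cx; apply: h; exists x. Qed.

Definition below d (B : ctbDistrLatticeType d) (M : bvmodel L B)
    (S : set rformula) (e : X -> M) (b : B) : Prop :=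
  forall c, S c -> b <= cval c e.

(** Testing against every common lower bound [b] stands for comparing with the infimum of the values
    of [S]. It also allows [b] to be cut down when a formula is added to [S], as in [belowU1]. *)
Definition entails (S : set rformula) (c : rformula) : Prop :=
  forall d (B : ctbDistrLatticeType d) (M : bvmodel L B),
    complete_lattice B -> mixing M ->
    forall (e : X -> M) (b : B), below S e b -> b <= cval c e.

Lemma entails_in (S : set rformula) c : S c -> entails S c.
Proof. by move=> Sc d B M _ _ e b; apply. Qed.

Lemma entailsS (S T : set rformula) c : S `<=` T -> entails S c -> entails T c.
Proof.
by move=> ST h d B M cB mM e b hb; apply: h => // c' /ST; apply: hb.
Qed.

Lemma below_ext d (B : ctbDistrLatticeType d) (M : bvmodel L B)
    (S : set rformula) (e e' : X -> M) (b : B) :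
  (forall x, (\bigcup_(c in S) cvars c) x -> e x = e' x) ->
  below S e b -> below S e' b.
Proof.
move=> h hb c Sc; rewrite -(@cval_ext _ _ _ _ e e') ?hb// => x cx.
by apply: h; exists c.
Qed.

Lemma belowU1 d (B : ctbDistrLatticeType d) (M : bvmodel L B)
    (S : set rformula) (e : X -> M) (b : B) c :
  below S e b -> below (S `|` [set c])%classic e (b `&` cval c e).
Proof.
move=> hb c' [Sc|->]; last exact: leIr.
by rewrite (le_trans (leIl _ _))// hb.
Qed.

Lemma eq_Neg_le d (B : ctbDistrLatticeType d) (b u v : B) :
  b <= ~` v -> u <= v -> b <= ~` u.
Proof. by move=> bv uv; apply: le_trans bv _; rewrite leC. Qed.

End Semantics.

(** * Fresh variables *)

Section Fresh.
Variable X : choiceType.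
Hypothesis X_infinite : infinite_set [set: X].

(** The complement of the finite set [F] contains a copy of the natural numbers, and [V] is numbered
    injectively by natural numbers. Every element of [T] is sent off [F], while injectivity concerns
    [V] alone. *)
Lemma fresh_renaming (T : Type) (F : set X) (V : set T) :
  finite_set F -> finite_set V ->
  exists2 y : T -> X, {in V &, injective y} & forall t, ~ F (y t).
Proof.
move=> finF finV.
have [h h_inj] := pcard_injP (finite_set_countable finV).
have : infinite_set ([set: X] `\` F)%classic by exact: infinite_setD.
move/infiniteP/card_leP => [f].
have nT (n : nat) : n \in [set: nat] by rewrite inE.
exists (fun t => val (f (SigSub (nT (h t))))).
  move=> s t sV tV /val_inj /inj; rewrite !inE => /(_ I I) /(congr1 val) /=.
  exact: h_inj.
by move=> t; have /set_mem[_] := valP (f (SigSub (nT (h t)))).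
Qed.

End Fresh.

(** * Separation by formulae of the common language, and preservation of inseparability *)

Section Separation.
Local Open Scope order_scope.
Variables (L : signature) (X : choiceType) (K : Type).
Hypothesis X_infinite : infinite_set [set: X].
Hypothesis bool_lt_K : card_lt bool K.
Variables (RL : bool -> set (relsym L)) (CL : bool -> set (cstsym L)).
Implicit Types (chi theta : formula L X) (i j : bool).

Definition in_lang i chi := rel_syms chi `<=` RL i /\ cst_syms chi `<=` CL i.

Definition state := bool -> set (rformula L X).
Implicit Types s : state.

Definition state_vars s : set X := \bigcup_i \bigcup_(c in s i) cvars c.

Definition add s i (c : rformula L X) : state :=
  fun j => (s j `|` [set c' | j = i /\ c' = c])%classic.

Definition separates s i theta :=
  [/\ Lkw K theta, forall j, in_lang j theta,
      entails (s i) (theta, id) & entails (s (~~ i)) (Neg theta, id)].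

Definition separable s := exists theta, separates s true theta.

(** Negating the separating formula exchanges the two sides. Each argument below can therefore be
    given once, for an arbitrary side [i]. *)
Lemma separableP s i : separable s <-> exists theta, separates s i theta.
Proof.
case: i => //; split=> -[theta [kt lt t1 t2]]; exists (Neg theta); split=> //=.
- by move=> d B M cB mM e b /t1 h; rewrite /cval/= complK; apply: h.
- by move=> d B M cB mM e b /t1 h; rewrite /cval/= complK; apply: h.
Qed.

Lemma addE s i c : add s i c i = (s i `|` [set c])%classic.
Proof. by rewrite /add; congr setU; apply/seteqP; split=> c' //= [_ ->]. Qed.

Lemma addNE s i c : add s i c (~~ i) = s (~~ i).
Proof.
rewrite /add; apply/seteqP; split=> c' //=; last by left.
by case=> // -[]; case: i.
Qed.

Lemma below_reassign d (B : ctbDistrLatticeType d) (M : bvmodel L B) s i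
    (V : {fset X}) (e e' : X -> M) (b : B) :
  (forall x, x \in V -> ~ state_vars s x) -> reassign V e e' ->
  below (s i) e b -> below (s i) e' b.
Proof.
move=> hV he; apply: below_ext => x sx; rewrite he//.
by apply/negP => /hV; apply; exists i.
Qed.

(* The variables that do not occur in the state are quantified universally. *)
Lemma separates_vars s i theta : separates s i theta ->
  exists2 theta', separates s i theta' & free_vars theta' `<=` state_vars s.
Proof.
case=> kt lt t1 t2.
have /finite_fsetP[V VE] :
    finite_set (free_vars theta `\` state_vars s)%classic.
  by apply: finite_setD; exact: Lkw_finite kt.
have VP x : (free_vars theta `\` state_vars s)%classic x = (x \in V).
  by rewrite VE.
have hV x : x \in V -> ~ state_vars s x by rewrite -VP => -[].
exists (All V theta); last first.
  move=> x /= [tx xV]; apply: contrapT => sx; apply: xV.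
  by have : (free_vars theta `\` state_vars s)%classic x by []; rewrite VP.
split=> // d B M cB mM e b hb; rewrite /cval/=.
- apply: le_Inf => // _ [e' he' <-]; apply: (t1 d B M cB mM e') => //.
  exact: below_reassign he' _.
- apply: eq_Neg_le (t2 d B M cB mM e b hb) _.
  by apply: Inf_le => //; exists e.
Qed.

(** A contradictory side has only [\bot] as a lower bound, so it entails the everywhere false
    formula [Neg (Eq x x)]. That formula contains no non-logical symbol and its negation is valid,
    so it separates. *)
Lemma sat_consistent s i c : ~ separable s ->
  entails (s i) c -> entails (s i) (Neg c.1, c.2) -> False.
Proof.
move=> ns h1 h2; apply: ns; apply/(separableP s i).
have [x _] := infinite_setN0 X_infinite.
exists (Neg (Eq (Var x) (Var x))); split=> //.
- by move=> j; split=> /= y // -[].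
- move=> d B M cB mM e b hb; rewrite /cval/= eqv_refl.
  have := h1 d B M cB mM e b hb; have := h2 d B M cB mM e b hb.
  rewrite /cval/= => b2 b1.
  have -> : b = \bot; last exact: le0x.
  by apply/eqP; rewrite -lex0 -(meetxC (value c.1 (e \o c.2))) lexI b1.
- by move=> d B M cB mM e b hb; rewrite /cval/= complK eqv_refl lex1.
Qed.

(** If [theta] separates once [alpha] has been added, then [Imp alpha theta] separates already: side
    [i] entails both [alpha] and the negation of [theta]. The implication is a disjunction over
    [bool], whence the appeal to [bool_lt_K]. *)
Lemma sat_share s i alpha : Lkw K alpha -> (forall j, in_lang j alpha) ->
  ~ separable s -> entails (s i) (alpha, id) ->
  ~ separable (add s (~~ i) (alpha, id)).
Proof.
move=> ka la ns ha; apply: contra_not ns.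
move/(separableP _ (~~ i)) => [theta [kt lt]].
rewrite addE addNE negbK => t1 t2.
apply/(separableP _ (~~ i)); exists (Imp alpha theta); split => /=.
- split=> //; last by case.
  apply: bigcup_finite => [|[] _ /=]; first exact: finite_finset.
  + exact: Lkw_finite ka.
  + exact: Lkw_finite kt.
- move=> j; have [ra ca] := la j; have [rt ct] := lt j.
  by split=> z /= [[] _ /=]; [exact: ra|exact: rt|exact: ca|exact: ct].
- move=> d B M cB mM e b hb; rewrite /cval/=.
  have := t1 d B M cB mM e _ (belowU1 (c := (alpha, id)) hb).
  rewrite /cval/= => h.
  have {}h : b <= ~` value alpha e `|` value theta e by rewrite -le_implE meetC.
  apply: le_trans h _; rewrite leUx; apply/andP; split.
  + by apply: le_Sup => //; exists true.
  + by apply: le_Sup => //; exists false.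
- rewrite negbK => d B M cB mM e b hb; rewrite /cval/=.
  have b1 := ha d B M cB mM e b hb; have := t2 d B M cB mM e b hb.
  rewrite /cval/= in b1 * => b2.
  rewrite lexC; apply: Sup_le => // _ [[] _ <-] /=; first by rewrite leC.
  by rewrite lexC.
Qed.

(** If each disjunct led to a separable state, the disjunction of the separating formulae would
    separate [s]; it has the same index type as [Disj Phi]. Its free variables are jointly finite
    because [separates_vars] confines them to the state and to the disjunction. *)
Lemma sat_split s i (I : Type) (Phi : I -> formula L X) sg :
  finite_set (state_vars s) -> Lkw K (Disj Phi) -> ~ separable s ->
  entails (s i) (Disj Phi, sg) -> exists n, ~ separable (add s i (Phi n, sg)).
Proof.
move=> fs [ltI fI _] ns ha; apply: contra_notP ns => /forallNP hn.
have {}hn n : exists theta, separates (add s i (Phi n, sg)) i theta /\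
    free_vars theta `<=` (state_vars s `|` cvars (Disj Phi, sg))%classic.
  have /contrapT/(separableP _ i)[theta0 /separates_vars[theta sep fv]] := hn n.
  exists theta; split=> // x /fv[j _ [c]]; rewrite /add /= => -[sc cx|].
    by left; exists j => //; exists c.
  by case=> _ -> [y py <-]; right; exists y => //; exists n.
have [theta thetaP] := choice hn.
apply/(separableP _ i); exists (Disj theta); split.
- split=> //; last by move=> n; have [[]] := thetaP n.
  apply: (@sub_finite_set _ _ (state_vars s `|` cvars (Disj Phi, sg))%classic).
    by move=> x [n _ tx]; have [_] := thetaP n; apply.
  by rewrite finite_setU; split=> //; apply: finite_image.
- move=> j; split=> z /= [n _]; have [[_ /(_ j)[r c] _ _] _] := thetaP n.
  + exact: r.
  + exact: c.
- move=> d B M cB mM e b hb.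
  apply: (le_Sup_elim cB (ha d B M cB mM e b hb)) => _ [n _ <-].
  have [[_ _ t1 _] _] := thetaP n.
  apply: le_trans (t1 d B M cB mM e _ _) _.
    by rewrite addE; apply: (belowU1 (c := (Phi n, sg))).
  by apply: le_Sup => //; exists n.
- move=> d B M cB mM e b hb; rewrite /cval/= lexC.
  apply: Sup_le => // _ [n _ <-]; have [[_ _ _ t2] _] := thetaP n.
  by rewrite lexC; apply: t2 => //; rewrite addNE.
Qed.

(** The variables of [V] are renamed to fresh ones, forming [Y]. If [theta] separates after the
    witness is added, [Ex Y theta] separates before, since neither side of [s] mentions [Y]. *)
Lemma sat_witness s i (V : {fset X}) chi sg :
  finite_set (state_vars s) -> Lkw K chi -> ~ separable s ->
  entails (s i) (Ex V chi, sg) ->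
  exists2 sg', (forall x, x \notin V -> sg' x = sg x) &
    ~ separable (add s i (chi, sg')).
Proof.
move=> fs kc ns ha.
have [||y y_inj yF] := @fresh_renaming X X_infinite X
    (state_vars s `|` cvars (Ex V chi, sg))%classic [set` V].
- rewrite finite_setU; split=> //; apply: finite_image.
  by apply: finite_setD; exact: Lkw_finite kc.
- exact: finite_fset.
exists (fun x => if x \in V then y x else sg x); first by move=> x /negbTE ->.
apply: contra_not ns => /(separableP _ i)[theta []].
set sg' := fun x => _; rewrite addE addNE => kt lt t1 t2.
have [Y YP] : exists Y : {fset X}, forall z,
    z \in Y <-> exists2 v, v \in V & z = y v.
  by exists [fset y x | x in V]%fset => z; split=> /imfsetP.
have Ys x : x \in Y -> ~ state_vars s x.
  by move=> /YP[v _ ->] sv; apply: (yF v); left.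
apply/(separableP _ i); exists (Ex Y theta); split=> //.
- move=> d B M cB mM e b hb.
  apply: (le_Sup_elim cB (ha d B M cB mM e b hb)) => _ [e1 he1 <-].
  (* [e2] moves the values that [e1] gives to [V] onto the fresh copies; injectivity of [y] on [V]
     makes this well defined. *)
  have [e2 he2 e2y] : exists2 e2 : X -> M, reassign Y e e2 &
      {in V, forall x, e2 (y x) = e1 x}.
    have /choice[g gP] : forall z, exists m : M,
        (forall x, x \in V -> y x = z -> m = e1 x) /\ (z \notin Y -> m = e z).
      move=> z; have [/YP[v vV ->]|zY] := boolP (z \in Y).
        by exists (e1 v); split=> // x xV /y_inj->; rewrite ?inE.
      exists (e z); split=> // x xV yz; move/negP: zY => [].
      by apply/YP; exists x.
    exists g => [z zY|x xV]; first by have [_] := gP z; apply.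
    by have [/(_ x xV erefl)] := gP (y x).
  have e12 : value chi e1 = cval (chi, sg') e2.
    apply: value_ext => x cx; rewrite /= /sg'; case: ifPn => xV.
      by rewrite e2y.
    rewrite he1// he2//; apply/negP => /YP[v vV yv].
    by apply: (yF v); right; exists x => //; split=> //; apply/negP.
  rewrite -[X in b `&` X]/(value chi e1) e12.
  apply: le_trans (t1 d B M cB mM e2 _ _) _.
    by apply: belowU1; exact: below_reassign he2 _.
  by apply: le_Sup => //; exists e2.
- move=> d B M cB mM e b hb; rewrite /cval/= lexC.
  apply: Sup_le => // _ [e' he' <-]; rewrite lexC.
  apply: (t2 d B M cB mM e') => //.
  exact: below_reassign he' _.
Qed.

End Separation.

(** * Derived rules for entailment, and tools for meeting dense requirements *)

Section SemanticConsequence.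
Local Open Scope order_scope.
Variables (L : signature) (X : choiceType).
Implicit Types (S : set (rformula L X)) (c : rformula L X).

Lemma entails_le S c c' : entails S c ->
  (forall d (B : ctbDistrLatticeType d) (M : bvmodel L B) (e : X -> M),
     complete_lattice B -> cval c e <= cval c' e) -> entails S c'.
Proof.
move=> h cc' d B M cB mM e b hb; apply: le_trans (cc' _ _ _ _ cB).
exact: h.
Qed.

Lemma entails_meet S c1 c2 c' : entails S c1 -> entails S c2 ->
  (forall d (B : ctbDistrLatticeType d) (M : bvmodel L B) (e : X -> M),
     complete_lattice B -> cval c1 e `&` cval c2 e <= cval c' e) ->
  entails S c'.
Proof.
move=> h1 h2 cc' d B M cB mM e b hb; apply: le_trans (cc' _ _ _ _ cB).
by rewrite lexI h1// h2.
Qed.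

Lemma compl_Inf_le d (B : ctbDistrLatticeType d) (I : Type) (A : set I)
    (F : I -> B) : complete_lattice B ->
  ~` Inf (F @` A) <= Sup ((fun i => ~` F i) @` A).
Proof.
move=> cB; rewrite leCx; apply: le_Inf => // _ [i Ai <-].
by rewrite leCx; apply: le_Sup => //; exists i.
Qed.

End SemanticConsequence.

(** The requirements are met one after another along the list; downward closure preserves those
    already met. *)
Lemma dense_choice (P : forcing) (T : eqType) (Y : Type)
    (Q : T -> Y -> set P) (s : seq T) (y0 : Y) p :
  (forall v y, downward (Q v y)) ->
  (forall v q, v \in s -> ext q p ->
     exists2 r, ext r q & exists y, Q v y r) ->
  exists2 q, ext q p & exists y : T -> Y, {in s, forall v, Q v (y v) q}.
Proof.
move=> dQ; elim: s => [|v s IH] hQ.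
  by exists p; [exact: ext_refl|exists (fun=> y0)].
have [|q qp [y hy]] := IH.
  by move=> w q ws; apply: hQ; rewrite inE ws orbT.
have [r rq [z hz]] := hQ v q (mem_head _ _) qp.
exists r; first exact: ext_trans qp.
exists (fun w => if w == v then z else y w) => w.
rewrite inE; case: eqP => [-> //|_ /= ws].
exact: dQ (hy w ws).
Qed.

Section Principal.
Variable P : forcing.
Local Open Scope order_scope.

(** This embeds conditions into the algebra, so that membership of [p] in a regular set becomes an
    inequality to which [value_congr] applies. *)
Definition principal (p : P) : regular P := rcl [set q | ext q p].

Lemma mem_principal p : principal p p.
Proof. by move=> q qp; exists q => //; exact: ext_refl. Qed.

Lemma principal_le p (U : regular P) : U p -> principal p <= U.
Proof.
move=> Up; apply/regular_leP => q hq; apply/rsetP.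
by apply: dense_belowS hq => r rp; apply: rset_ext Up.
Qed.
End Principal.

(** * The generic model of names over the inseparable states, and its truth lemma *)

Section GenericModel.
Local Open Scope order_scope.
Variables (L : signature) (X : choiceType) (K : Type).
Hypothesis X_infinite : infinite_set [set: X].
Hypothesis bool_lt_K : card_lt bool K.
Variables (RL : bool -> set (relsym L)) (CL : bool -> set (cstsym L)).
Hypothesis CL_cover : forall c, exists i, CL i c.
Implicit Types (chi alpha : formula L X) (t : term L X).

Local Notation separable := (@separable L X K RL CL).
Local Notation in_lang := (@in_lang L X RL CL).

Definition inseparable (s : state L X) : Prop :=
  finite_set (state_vars s) /\ ~ separable s.

Definition state_ext (q p : {s | inseparable s}) : Prop :=
  forall i, sval p i `<=` sval q i.

Lemma state_ext_refl p : state_ext p p.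
Proof. by move=> i. Qed.

Lemma state_ext_trans p q r : state_ext r q -> state_ext q p -> state_ext r p.
Proof. by move=> rq qp i; apply: subset_trans (rq i). Qed.

Definition state_forcing : forcing := Forcing state_ext_refl state_ext_trans.
Local Notation P := state_forcing.
Local Notation B := (regular P).
Implicit Types p q r : P.

Definition proves i p (c : rformula L X) := entails (sval p i) c.

Lemma proves_ext i p q c : ext q p -> proves i p c -> proves i q c.
Proof. by move=> /(_ i); exact: entailsS. Qed.

Lemma ext_add i p chi sg : Lkw K chi ->
  ~ separable (add (sval p) i (chi, sg)) ->
  exists2 q, ext q p & proves i q (chi, sg).
Proof.
case: p => s [fs ns] /= kc h.
have hs : inseparable (add s i (chi, sg)).
  split=> //.
  apply: (@sub_finite_set _ _ (state_vars s `|` cvars (chi, sg))%classic).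
    move=> x [j _ [c [sc|[_ ->]] cx]]; last by right.
    by left; exists j => //; exists c.
  rewrite finite_setU; split=> //; apply: finite_image.
  exact: Lkw_finite kc.
exists (exist _ _ hs : P); first by move=> j c sc; left.
by apply: entails_in; right.
Qed.

Definition tval alpha : B :=
  rcl [set p | exists i, in_lang i alpha /\ proves i p (alpha, id)].

Lemma tval_intro i p alpha : in_lang i alpha -> proves i p (alpha, id) ->
  tval alpha p.
Proof.
move=> la pa q qp; exists q; first exact: ext_refl.
by exists i; split=> //; apply: proves_ext qp pa.
Qed.

(** The entailment may come from the other side. Then [alpha] lies in both languages, and
    [sat_share] allows it to be added to side [i]. *)
Lemma tval_elim i p alpha : Lkw K alpha -> in_lang i alpha -> tval alpha p ->
  exists2 q, ext q p & proves i q (alpha, id).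
Proof.
move=> ka la /(_ p (ext_refl p))[q qp [j [lj qa]]].
have [ij|/eqP ij] := eqVneq i j; first by exists q => //; rewrite ij.
have la' j' : in_lang j' alpha.
  by case: i j j' ij la lj {qa} => -[] [].
have [_ ns] : inseparable (sval q) by case: q {qa qp}.
have /ext_add[//|r rq ra] := sat_share bool_lt_K ka la' ns qa.
exists r; first exact: ext_trans qp.
by move: ra; rewrite (_ : ~~ j = i)//; case: i j ij {la lj qa} => -[].
Qed.

Lemma tval_elim_Eq i p s t : in_lang i (Eq s t) -> tval (Eq s t) p ->
  exists2 q, ext q p & proves i q (Eq s t, id).
Proof. exact: tval_elim. Qed.

Lemma proves_witness i p V chi sg : Lkw K chi -> proves i p (Ex V chi, sg) ->
  exists2 q, ext q p & exists2 sg', (forall x, x \notin V -> sg' x = sg x) &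
    proves i q (chi, sg').
Proof.
move=> kc; case: (svalP p) => fs ns /(sat_witness X_infinite fs kc ns).
by case=> sg' hsg /(ext_add kc)[q qp h]; exists q => //; exists sg'.
Qed.

Lemma proves_split i p (I : Type) (Phi : I -> formula L X) sg :
  Lkw K (Disj Phi) -> proves i p (Disj Phi, sg) ->
  exists2 q, ext q p & exists n, proves i q (Phi n, sg).
Proof.
move=> kc; case: (svalP p) => fs ns /(sat_split fs kc ns).
case=> n /ext_add[|q qp h]; first by case: kc => _ _ kn; exact: kn.
by exists q => //; exists n.
Qed.

Lemma proves_consistent i p chi sg :
  proves i p (chi, sg) -> proves i p (Neg chi, sg) -> False.
Proof. by case: (svalP p) => _ ns; exact: (sat_consistent X_infinite ns). Qed.

(** A name is a Boolean-valued description of one variable up to forced equality, with [nval x] the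
    value of its being equal to [x]. Such functions, unlike bare variables, can be glued along an
    antichain, see [mix]. *)
Record name := Name {
  nval :> X -> B;
  nval_ext : forall x y p,
    nval x p -> tval (Eq (Var x) (Var y)) p -> nval y p;
  nval_uniq : forall x y p,
    nval x p -> nval y p -> tval (Eq (Var x) (Var y)) p;
  nval_total : forall p, exists2 q, ext q p & exists x, nval x q }.

Lemma in_lang_Eq i s t : term_csts s `<=` CL i -> term_csts t `<=` CL i ->
  in_lang i (Eq s t).
Proof. by move=> hs ht; split=> // c [/hs|/ht]. Qed.

Lemma term_lang t : exists i, term_csts t `<=` CL i.
Proof.
by case: t => [x|c]; [exists true|have [i ic] := CL_cover c; exists i => _ ->].
Qed.

Lemma entails_Eq_trans S s t u :
  entails S (Eq s t, id) -> entails S (Eq t u, id) ->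
  entails S (Eq s u, id : X -> X).
Proof.
by move=> h1 h2; apply: (entails_meet h1 h2) => d B M e cB; exact: eqv_trans.
Qed.

Lemma entails_Eq_sym S s t :
  entails S (Eq s t, id) -> entails S (Eq t s, id : X -> X).
Proof.
by move=> h; apply: (entails_le h) => d B M e cB; rewrite /cval/= eqv_sym.
Qed.

(** The two equations may have been forced by different sides. An equation between variables belongs
    to both languages, so both can be brought to a side whose language contains [t], where
    transitivity applies. *)
Lemma tname_ext t x y p : tval (Eq t (Var x)) p ->
  tval (Eq (Var x) (Var y)) p -> tval (Eq t (Var y)) p.
Proof.
move=> tx xy; apply/rsetP => q qp; have [i ti] := term_lang t.
have lx z : in_lang i (Eq t (Var z)) by exact: in_lang_Eq.
have lxy : in_lang i (Eq (Var x) (Var y)) by exact: in_lang_Eq.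
have [r rq rx] := tval_elim_Eq (lx x) (rset_ext qp tx).
have [r' rr ry] := tval_elim_Eq lxy (rset_ext (ext_trans rq qp) xy).
exists r'; first exact: ext_trans rq.
apply: tval_intro (lx y) _.
by apply: entails_Eq_trans ry; apply: proves_ext rr rx.
Qed.

Lemma tname_uniq t x y p : tval (Eq t (Var x)) p ->
  tval (Eq t (Var y)) p -> tval (Eq (Var x) (Var y)) p.
Proof.
move=> tx ty; apply/rsetP => q qp; have [i ti] := term_lang t.
have lx z : in_lang i (Eq t (Var z)) by exact: in_lang_Eq.
have lxy : in_lang i (Eq (Var x) (Var y)) by exact: in_lang_Eq.
have [r rq rx] := tval_elim_Eq (lx x) (rset_ext qp tx).
have [r' rr ry] := tval_elim_Eq (lx y) (rset_ext (ext_trans rq qp) ty).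
exists r'; first exact: ext_trans rq.
apply: tval_intro lxy _.
by apply: entails_Eq_trans ry; apply: entails_Eq_sym; apply: proves_ext rr rx.
Qed.

Lemma proves_refl i p t : proves i p (Eq t t, id).
Proof. by move=> d B M cB mM e b _; rewrite /cval/= eqv_refl lex1. Qed.

Lemma tval_refl p x : tval (Eq (Var x) (Var x)) p.
Proof.
by apply: (@tval_intro true); [exact: in_lang_Eq|exact: proves_refl].
Qed.

Lemma tname_total t p : exists2 q, ext q p & exists x, tval (Eq t (Var x)) q.
Proof.
case: t => [x|c].
  by exists p; [exact: ext_refl|exists x; exact: tval_refl].
have [x _] := infinite_setN0 X_infinite.
have [i ic] := CL_cover c.
(* Every model satisfies that some [x] equals [c]; a fresh witness for it is a variable denoting
   [c]. *)
have : proves i p (Ex [fset x]%fset (Eq (Cst c) (Var x)), id).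
  move=> d B M cB mM e b _; rewrite /cval/=; apply: le_trans (lex1 _) _.
  rewrite -(eqv_refl (cstv M c)); apply: le_Sup => //.
  exists (fun y => if y == x then cstv M c else e y); last by rewrite eqxx.
  by move=> y; rewrite inE => /negbTE->.
case/proves_witness => // q qp [sg _ h]; exists q => //; exists (sg x).
by apply: (@tval_intro i) => //; apply: in_lang_Eq => // _ ->.
Qed.

Definition tname t : name :=
  Name (@tname_ext t) (@tname_uniq t) (@tname_total t).

Definition name_eqv (f g : name) : B := Sup (range (fun x => f x `&` g x)).

Lemma mem_name_eqv f g p : name_eqv f g p <->
  dense_below p [set q | exists x, f x q /\ g x q].
Proof.
split=> [/mem_Sup|] h; [|apply/mem_Sup]; apply: dense_belowS h => q.
- by case=> _ [x _ <-] []; exists x.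
- by case=> x xq; exists (f x `&` g x) => //; exists x.
Qed.

Definition name_relv (R : relsym L) (f : 'I_(arity R) -> name) : B :=
  Sup (range (fun x : 'I_(arity R) -> X =>
    (\meet_i f i (x i)) `&` tval (Rel R (Var \o x)))).

Lemma mem_name_relv R (f : 'I_(arity R) -> name) p : name_relv f p <->
  dense_below p [set q | exists x : 'I_(arity R) -> X,
    (forall i, f i (x i) q) /\ tval (Rel R (Var \o x)) q].
Proof.
split=> [/mem_Sup|] h; [|apply/mem_Sup]; apply: dense_belowS h => q.
- by case=> _ [x _ <-] [] /mem_rbigmeet; exists x.
- case=> x [fx Rx]; exists ((\meet_i f i (x i)) `&` tval (Rel R (Var \o x))).
    by exists x.
  by split=> //; apply/mem_rbigmeet.
Qed.

Lemma name_eqv_refl f : name_eqv f f = \top.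
Proof.
apply/eqP; rewrite -le1x; apply/regular_leP => p _; apply/mem_name_eqv => q _.
by have [r rq [x fx]] := nval_total f q; exists r => //; exists x.
Qed.

Lemma name_eqv_sym f g : name_eqv f g = name_eqv g f.
Proof.
apply: regular_inj => p; rewrite !mem_name_eqv.
by split; apply: dense_belowS => q [x []]; exists x.
Qed.

Lemma name_eqv_at f g p x : name_eqv f g p -> f x p -> g x p.
Proof.
move=> /mem_name_eqv fg fx; apply/rsetP => q qp.
have [r rq [y [fy gy]]] := fg q qp; exists r => //.
apply: nval_ext gy (nval_uniq fy _).
by apply: rset_ext fx; apply: ext_trans qp.
Qed.

Lemma name_eqv_trans f g h : name_eqv f g `&` name_eqv g h <= name_eqv f h.
Proof.
apply/regular_leP => p [/mem_name_eqv fg gh]; apply/mem_name_eqv => q qp.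
have [r rq [x [fx gx]]] := fg q qp; exists r => //; exists x; split=> //.
by apply: name_eqv_at gx; apply: rset_ext gh; apply: ext_trans qp.
Qed.

Lemma name_relv_congr R (f g : 'I_(arity R) -> name) :
  (\meet_(i < arity R) name_eqv (f i) (g i)) `&` name_relv f <= name_relv g.
Proof.
apply/regular_leP => p [/mem_rbigmeet fg /mem_name_relv Rf].
apply/mem_name_relv => q qp.
have [r rq [x [fx Rx]]] := Rf q qp; exists r => //; exists x; split=> // i.
by apply: name_eqv_at (fx i); apply: rset_ext (fg i); apply: ext_trans qp.
Qed.

Lemma name_inhabited : inhabited name.
Proof.
by have [x _] := infinite_setN0 X_infinite; exists; exact: tname (Var x).
Qed.

Definition generic_model : bvmodel L B := BVModel (tname \o Cst) name_inhabited
  name_eqv_refl name_eqv_sym name_eqv_trans name_relv_congr.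

Section Mixing.
Variables (A : set B) (f : B -> name) (x0 : X).
Hypothesis antichainA : incompatible_family A.

(* The mixture of the names [f a] is padded outside the supremum of [A] by the
   name of [x0], so as to be total. *)
Definition mix_set (x : X) : set P := [set p |
  (exists a, [/\ A a, a p & f a x p]) \/
  ((forall a, A a -> (~` a : B) p) /\ tval (Eq (Var x0) (Var x)) p)].

Lemma mix_set_down x : downward (mix_set x).
Proof.
move=> p q qp [[a [Aa ap fx]]|[nA tx]].
- by left; exists a; split=> //; [exact: rset_ext ap|exact: rset_ext fx].
- right; split; last exact: rset_ext tx.
  by move=> a Aa; exact: rset_ext (nA a Aa).
Qed.

Lemma mix_ext x y p : rcl (mix_set x) p ->
  tval (Eq (Var x) (Var y)) p -> rcl (mix_set y) p.
Proof.
move=> hx xy q qp; have [r rq [[a [Aa ar fx]]|[nA tx]]] := hx q qp.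
- exists r => //; left; exists a; split=> //; apply: nval_ext fx _.
  by apply: rset_ext xy; apply: ext_trans qp.
- exists r => //; right; split=> //; apply: tname_ext tx _.
  by apply: rset_ext xy; apply: ext_trans qp.
Qed.

(** On a common extension both variables come from the same element of [A], as distinct elements are
    incompatible, or both from the padding, which excludes all of [A]. *)
Lemma mix_uniq x y p : rcl (mix_set x) p -> rcl (mix_set y) p ->
  tval (Eq (Var x) (Var y)) p.
Proof.
move=> hx hy; apply/rsetP => q qp.
have [r rq hxr] := hx q qp.
have [r' rr hyr] := hy r (ext_trans rq qp).
exists r'; first exact: ext_trans rq.
have {hxr} hxr := mix_set_down rr hxr.
case: hxr hyr => [[a [Aa ap fx]]|[nA tx]] [[a' [Aa' ap' fy]]|[nA' ty]].
- have [aa'|/eqP aa'] := eqVneq a a'.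
    by apply: nval_uniq fx _; rewrite aa'.
  have : (a `&` a') r' by [].
  by rewrite (antichainA Aa Aa' aa') => /mem_rbot.
- by case: (nA' _ Aa r' (ext_refl r') ap).
- by case: (nA _ Aa' r' (ext_refl r') ap').
- exact: tname_uniq tx ty.
Qed.

Lemma mix_total p : exists2 q, ext q p & exists x, rcl (mix_set x) q.
Proof.
(* Either some extension of [p] enters an element of [A], or [p] already lies in the complements of
   all of them and the padding takes over. *)
have [[a Aa [q qp aq]]|hA] :=
  pselect (exists2 a, A a & exists2 q, ext q p & a q).
- have [r rq [x fx]] := nval_total (f a) q.
  exists r; first exact: ext_trans qp.
  exists x; apply: dense_below_down; first exact: mix_set_down.
  by left; exists a; split=> //; apply: rset_ext aq.
- exists p; first exact: ext_refl.
  exists x0; apply: dense_below_down; first exact: mix_set_down.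
  right; split; last exact: tval_refl.
  move=> a Aa; apply/mem_rcompl => q qp aq; apply: hA.
  by exists a => //; exists q.
Qed.

Definition mix : name := Name mix_ext mix_uniq mix_total.

Lemma le_mix a : A a -> a <= name_eqv mix (f a).
Proof.
move=> Aa; apply/regular_leP => p ap; apply/mem_name_eqv => q qp.
have [r rq [x fx]] := nval_total (f a) q; exists r => //; exists x; split=> //.
apply: dense_below_down; first exact: mix_set_down.
by left; exists a; split=> //; apply: rset_ext ap; apply: ext_trans qp.
Qed.
End Mixing.

Lemma generic_mixing : mixing generic_model.
Proof.
move=> A f hA; have [x0 _] := infinite_setN0 X_infinite.
by exists (mix f x0 hA) => a; exact: le_mix.
Qed.

Local Notation vname := (fun x : X => tname (Var x) : carrier generic_model).

Lemma tname_term_value t sg :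
  term_value t (vname \o sg) = tname (term_subst sg t).
Proof. by case: t. Qed.

Lemma proves_subst_Eq i p s t sg : proves i p (Eq s t, sg) <->
  proves i p (Eq (term_subst sg s) (term_subst sg t), id).
Proof.
by split=> h; apply: (entails_le h) => d B M e cB; rewrite /cval/= !term_substE.
Qed.

Lemma proves_subst_Rel i p R (t : 'I_(arity R) -> term L X) sg :
  proves i p (Rel R t, sg) <->
  proves i p (Rel R (term_subst sg \o t), id).
Proof.
have E d (B' : ctbDistrLatticeType d) (M : bvmodel L B') (e : X -> M) :
    cval (Rel R t, sg) e = cval (Rel R (term_subst sg \o t), id) e.
  by congr (relv M R _); apply/funext => k; exact/esym/term_substE.
by split=> h; apply: (entails_le h) => d B' M e _; rewrite E.
Qed.

Lemma proves_term i p t : term_csts t `<=` CL i ->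
  exists2 q, ext q p & exists x, proves i q (Eq t (Var x), id).
Proof.
move=> ti; have [q qp [x tx]] := tname_total t p.
have lx : in_lang i (Eq t (Var x)) by exact: in_lang_Eq.
have [r rq rx] := tval_elim_Eq lx tx.
by exists r; [exact: ext_trans qp|exists x].
Qed.

Lemma term_subst_csts sg t : term_csts (term_subst sg t) = term_csts t.
Proof. by case: t. Qed.

Lemma entails_Rel_congr S R (s t : 'I_(arity R) -> term L X) :
  (forall k, entails S (Eq (s k) (t k), id)) -> entails S (Rel R s, id) ->
  entails S (Rel R t, id).
Proof.
move=> hst hs d B0 M cB mM e b hb; apply: le_trans (relv_congr _ _).
rewrite lexI; apply/andP; split; last exact: (hs d B0 M cB mM e b hb).
by apply/meetsP => k _; exact: (hst k d B0 M cB mM e b hb).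
Qed.

Lemma proves_term_tuple i p n (t : 'I_n -> term L X) :
  (forall k, term_csts (t k) `<=` CL i) ->
  exists2 q, ext q p &
    exists x, forall k, proves i q (Eq (t k) (Var (x k)), id).
Proof.
move=> ti; have [x0 _] := infinite_setN0 X_infinite.
have [|k q _ _|q qp [x hx]] := @dense_choice P 'I_n X
    (fun k x => [set q | proves i q (Eq (t k) (Var x), id)]) (enum 'I_n) x0 p.
- by move=> k x q r rq; exact: proves_ext.
- exact: proves_term.
- by exists q => //; exists x => k; apply: hx; rewrite mem_enum.
Qed.

Lemma proves_tname_tuple i p n (t : 'I_n -> term L X) (x : 'I_n -> X) :
  (forall k, term_csts (t k) `<=` CL i) -> (forall k, tname (t k) (x k) p) ->
  exists2 q, ext q p & forall k, proves i q (Eq (t k) (Var (x k)), id).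
Proof.
move=> ti tx.
have [|k q _ qp|q qp [_ hx]] := @dense_choice P 'I_n unit
    (fun k _ => [set q | proves i q (Eq (t k) (Var (x k)), id)])
    (enum 'I_n) tt p.
- by move=> k _ q r rq; exact: proves_ext.
- have lk : in_lang i (Eq (t k) (Var (x k))) by exact: in_lang_Eq.
  have [r rq h] := tval_elim_Eq lk (rset_ext qp (tx k)).
  by exists r => //; exists tt.
- by exists q => // k; apply: hx; rewrite mem_enum.
Qed.

Lemma in_lang_Rel i R (x : 'I_(arity R) -> X) : RL i R ->
  in_lang i (Rel R (Var \o x)).
Proof. by move=> iR; split=> /= z => [->|[]]. Qed.

Lemma tval_elim_Rel i p R (x : 'I_(arity R) -> X) : RL i R ->
  tval (Rel R (Var \o x)) p ->
  exists2 q, ext q p & proves i q (Rel R (Var \o x), id).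
Proof. by move=> iR; apply: tval_elim => //; exact: in_lang_Rel. Qed.

(** If [s = t] is entailed, a variable denoting [s] on an extension denotes [t] as well. If its
    negation is entailed, a shared variable would give both equations to side [i], against
    [proves_consistent]. *)
Lemma truth_Eq i p s t : in_lang i (Eq s t) ->
  (proves i p (Eq s t, id) -> name_eqv (tname s) (tname t) p) /\
  (proves i p (Neg (Eq s t), id) ->
   (~` name_eqv (tname s) (tname t) : B) p).
Proof.
case=> _ ci; have si c : term_csts s c -> CL i c by move=> h; apply: ci; left.
have ti c : term_csts t c -> CL i c by move=> h; apply: ci; right.
have ls x : in_lang i (Eq s (Var x)) by exact: in_lang_Eq.
have lt x : in_lang i (Eq t (Var x)) by exact: in_lang_Eq.
split=> h.
- apply/mem_name_eqv => q qp; have [r rq [x sx]] := proves_term q si.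
  exists r => //; exists x; split; first exact: tval_intro sx.
  apply: tval_intro (lt x) _; apply: entails_Eq_trans sx.
  apply: entails_Eq_sym; apply: proves_ext h; exact: ext_trans qp.
- apply/mem_rcompl => q qp /mem_name_eqv /(_ q (ext_refl q))[r rq [x [sx tx]]].
  have [r1 r1r s1] := tval_elim_Eq (ls x) sx.
  have [r2 r21 t2] := tval_elim_Eq (lt x) (rset_ext r1r tx).
  apply: (@proves_consistent i r2 (Eq s t) id).
    apply: entails_Eq_trans (proves_ext r21 s1) _; exact: entails_Eq_sym.
  apply: proves_ext h.
  by do 3![apply: ext_trans; first eassumption].
Qed.

Lemma truth_Rel i p R (t : 'I_(arity R) -> term L X) : in_lang i (Rel R t) ->
  (proves i p (Rel R t, id) -> name_relv (tname \o t) p) /\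
  (proves i p (Neg (Rel R t), id) -> (~` name_relv (tname \o t) : B) p).
Proof.
case=> /(_ R erefl) iR ci.
have ti k : term_csts (t k) `<=` CL i by move=> c tc; apply: ci; exists k.
split=> h.
- apply/mem_name_relv => q qp; have [r rq [x tx]] := proves_term_tuple q ti.
  exists r => //; exists x; split=> [k|].
    by apply: (@tval_intro i) => //; exact: in_lang_Eq.
  apply: (@tval_intro i); first exact: in_lang_Rel.
  apply: (entails_Rel_congr tx).
  by apply: proves_ext h; exact: ext_trans qp.
- apply/mem_rcompl => q qp /mem_name_relv /(_ q (ext_refl q))[r rq [x [tx Rx]]].
  have [r1 r1r t1] := proves_tname_tuple ti tx.
  have [r2 r21 R2] := tval_elim_Rel iR (rset_ext r1r Rx).
  apply: (@proves_consistent i r2 (Rel R t) id).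
    apply: entails_Rel_congr R2 => k; apply: entails_Eq_sym.
    exact: proves_ext r21 (t1 k).
  apply: proves_ext h.
  by do 3![apply: ext_trans; first eassumption].
Qed.

(** Each name agrees with some variable on an extension, and [V] is finite. Quantification over all
    names thereby reduces to renamings, which is what entailment speaks about. *)
Lemma reassign_names p V sg (e : X -> generic_model) :
  reassign V (vname \o sg) e ->
  exists2 q, ext q p & exists2 sg', (forall x, x \notin V -> sg' x = sg x) &
    forall x, name_eqv (e x) (vname (sg' x)) q.
Proof.
move=> he; have [x0 _] := infinite_setN0 X_infinite.
have [|v q _ _|q qp [y hy]] := @dense_choice P X X
    (fun v x => [set q | (e v : name) x q]) (enum_fset V) x0 p.
- by move=> v x q r rq; exact: rset_ext.
- exact: nval_total.
- exists q => //; exists (fun x => if x \in V then y x else sg x) => x.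
    by move/negbTE->.
  case: ifPn => [xV|xV]; last first.
    by rewrite (he x xV) /= name_eqv_refl; exact: mem_rtop.
  apply/mem_name_eqv => r rq; exists r; first exact: ext_refl.
  exists (y x); split; first exact: rset_ext (hy x xV).
  exact: tval_refl.
Qed.

Lemma generic_value_congr chi p (e e' : X -> generic_model) :
  (forall x, name_eqv (e x) (e' x) p) -> value chi e p -> value chi e' p.
Proof.
move=> h ve.
have /regular_leP := @value_congr L X _ B generic_model (@regular_complete P)
  chi e e' (principal p) (fun x => principal_le (h x)).
by apply; split=> //; exact: mem_principal.
Qed.

(** A condition may entail neither a formula nor its negation, so the two implications are proved
    together; negation turns each into the other. The renaming [sg] varies in the induction because
    quantifiers change it. *)
Lemma truth_lemma i chi : Lkw K chi -> in_lang i chi -> forall p sg,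
  (proves i p (chi, sg) -> value chi (vname \o sg) p) /\
  (proves i p (Neg chi, sg) -> (~` value chi (vname \o sg) : B) p).
Proof.
elim: chi => [s t|R t|phi IH|I Phi IH|I Phi IH|V phi IH|V phi IH] kc lc p sg.
- have : in_lang i (Eq (term_subst sg s) (term_subst sg t)).
    by case: lc => /= r c; split; rewrite //= !term_subst_csts.
  move/(truth_Eq p) => [h1 h2]; rewrite /= !tname_term_value.
  split=> [/proves_subst_Eq //|h].
  apply: h2; apply: (entails_le h) => d B' M e cB.
  by rewrite /cval/= !term_substE.
- have : in_lang i (Rel R (term_subst sg \o t)).
    case: lc => /= r c; split=> //= z [k _]; rewrite term_subst_csts => tz.
    by apply: c; exists k.
  move/(truth_Rel p) => [h1 h2].
  have -> : value (Rel R t) (vname \o sg) =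
      name_relv (tname \o (term_subst sg \o t)).
    congr name_relv; apply/funext => k /=; exact: tname_term_value.
  split=> [/proves_subst_Rel //|h].
  apply: h2; apply: (entails_le h) => d B' M e cB.
  rewrite /cval/= leC le_eqVlt; apply/orP; left; apply/eqP.
  by congr (relv M R _); apply/funext => k; exact/term_substE.
- have [h1 h2] := IH kc lc p sg; split=> // h.
  rewrite -[value (Neg phi) _]/(~` value phi (vname \o sg)) complK.
  apply: h1; apply: (entails_le h) => d B' M e cB.
  by rewrite /cval/= complK.
- have kn n : Lkw K (Phi n) by case: kc => _ _ h; exact: h.
  have ln n : in_lang i (Phi n).
    by case: lc => r c; split=> z hz; [apply: r|apply: c]; exists n.
  split=> h; first apply/mem_Inf => _ [n _ <-].
    have [h' _] := IH n (kn n) (ln n) p sg.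
    apply: h'; apply: (entails_le h) => d B' M e cB.
    by apply: Inf_le => //; exists n.
  apply/mem_rcompl => q qp /mem_Inf hq.
  (* The negated conjunction entails the disjunction of the negations, which obeys the same bounds
     by conversion; splitting it yields a conjunct refuted on an extension. *)
  have kN : Lkw K (Disj (fun n => Neg (Phi n))) by exact: kc.
  have [|r rq [n rn]] := proves_split (i := i) (p := q) (sg := sg) kN.
    apply: (entails_le (proves_ext qp h)) => d B' M e cB.
    exact: (@compl_Inf_le _ _ _ setT (fun n => value (Phi n) (e \o sg))).
  have [_ h'] := IH n (kn n) (ln n) r sg.
  have /mem_rcompl /(_ r (ext_refl r)) := h' rn; apply.
  by apply: rset_ext rq _; apply: hq; exists n.
- have kn n : Lkw K (Phi n) by case: kc => _ _ h; exact: h.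
  have ln n : in_lang i (Phi n).
    by case: lc => r c; split=> z hz; [apply: r|apply: c]; exists n.
  split=> h.
    apply/mem_Sup => q qp.
    have [r rq [n rn]] := proves_split kc (proves_ext qp h).
    exists r => //; exists (value (Phi n) (vname \o sg)); first by exists n.
    by have [h' _] := IH n (kn n) (ln n) r sg; exact: h'.
  apply/mem_rcompl => q qp /mem_Sup /(_ q (ext_refl q))[r rq [_ [n _ <-] rn]].
  have [_ h'] := IH n (kn n) (ln n) r sg.
  have /mem_rcompl /(_ r (ext_refl r)) : (~` value (Phi n) (vname \o sg) : B) r.
    apply: h'; apply: (entails_le (proves_ext (ext_trans rq qp) h)).
    move=> d B' M e cB.
    by rewrite /cval/= leC; apply: le_Sup => //; exists n.
  by apply.
- split=> h.
    apply/mem_Inf => _ [e he <-]; apply/rsetP => q qp.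
    (* The arbitrary names are replaced by variables on an extension, where the universal formula
       entails its instance at [sg']. *)
    have [r rq [sg' hsg he']] := reassign_names q he; exists r => //.
    have [h' _] := IH kc lc r sg'.
    have hr : value phi (vname \o sg') r.
      apply: h'; apply: (entails_le (proves_ext (ext_trans rq qp) h)).
      move=> d B' M e' cB; apply: Inf_le => //.
      by exists (e' \o sg') => // x xV /=; rewrite hsg.
    by apply: generic_value_congr hr => x; rewrite name_eqv_sym.
  apply/mem_rcompl => q qp /mem_Inf hq.
  have : proves i q (Ex V (Neg phi), sg).
    apply: (entails_le (proves_ext qp h)) => d B' M e cB.
    exact: compl_Inf_le.
  case/proves_witness => // r rq [sg' hsg hr].
  have [_ h'] := IH kc lc r sg'.
  have /mem_rcompl /(_ r (ext_refl r)) := h' hr; apply.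
  apply: rset_ext rq _; apply: hq; exists (vname \o sg') => // x xV /=.
  by rewrite hsg.
- split=> h.
    apply/mem_Sup => q qp.
    have [//|r rq [sg' hsg hr]] := proves_witness _ (proves_ext qp h).
    exists r => //; exists (value phi (vname \o sg')).
      by exists (vname \o sg') => // x xV /=; rewrite hsg.
    by have [h' _] := IH kc lc r sg'; exact: h'.
  apply/mem_rcompl => q qp /mem_Sup /(_ q (ext_refl q))[r rq [_ [e he <-] rn]].
  (* A witness among the names becomes a renaming, and the negated existential formula refutes that
     instance. *)
  have [r' rr [sg' hsg he']] := reassign_names r he.
  have [_ h'] := IH kc lc r' sg'.
  have /mem_rcompl /(_ r' (ext_refl r')) : (~` value phi (vname \o sg') : B) r'.
    apply: h'.
    apply: (entails_le (proves_ext (ext_trans rr (ext_trans rq qp)) h)).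
    move=> d B' M e' cB; rewrite /cval/= leC; apply: le_Sup => //.
    by exists (e' \o sg') => // x xV /=; rewrite hsg.
  apply; apply: generic_value_congr he' _; exact: rset_ext rn.
Qed.

End GenericModel.

(** * Validity of an implication as an inequality of values *)

Section Validity.
Local Open Scope order_scope.
Variables (L : signature) (X : choiceType).
Implicit Types (phi psi : formula L X).

Lemma value_Imp_top d (B : ctbDistrLatticeType d) (M : bvmodel L B)
    (e : X -> M) phi psi : complete_lattice B ->
  value (Imp phi psi) e = \top <-> value phi e <= value psi e.
Proof.
move=> cB; have -> : value (Imp phi psi) e = ~` value phi e `|` value psi e.
  apply/eqP; rewrite eq_le; apply/andP; split.
    by apply: Sup_le => // _ [[] _ <-]; [exact: leUl|exact: leUr].
  rewrite leUx; apply/andP; split.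
  + by apply: le_Sup => //; exists true.
  + by apply: le_Sup => //; exists false.
split=> [h|h].
- by rewrite -[value phi e]meetx1 le_implE h lex1.
- by apply/eqP; rewrite -le1x -le_implE meetx1.
Qed.

Lemma Sh_valid_Imp phi psi : Sh_valid (Imp phi psi) <->
  forall d (B : ctbDistrLatticeType d) (M : bvmodel L B),
    complete_lattice B -> mixing M ->
    forall e : X -> M, value phi e <= value psi e.
Proof.
split=> h d B M cB mM e; last by apply/value_Imp_top => //; exact: h.
by apply/value_Imp_top => //; exact: h.
Qed.

End Validity.

(** * Interpolation when [K] has at least three elements *)

Section LargeCardinal.
Local Open Scope order_scope.
Variables (L : signature) (X : choiceType) (K : Type).
Hypothesis X_infinite : infinite_set [set: X].
Hypothesis bool_lt_K : card_lt bool K.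
Variables phi psi : formula L X.
Hypotheses (sphi : sentence K phi) (spsi : sentence K psi).
Hypothesis phi_psi : Sh_valid (Imp phi psi).

(* Symbols occurring in neither sentence are put on the left, so that the two
   languages cover the signature and meet in the common symbols. *)
Definition left_right (T : Type) (A B : set T) (i : bool) : set T :=
  if i then (~` (B `\` A))%classic else B.

Lemma left_right_cover (T : Type) (A B : set T) t :
  exists i, left_right A B i t.
Proof.
by have [Bt|nBt] := pselect (B t); [exists false|exists true => -[]].
Qed.

Lemma left_right_meet (T : Type) (A B C : set T) :
  (forall i, C `<=` left_right A B i) -> (C `<=` A `&` B)%classic.
Proof.
move=> h t Ct; have Bt := h false t Ct; split=> //.
by apply: contrapT => nAt; apply: (h true t Ct).
Qed.

Let RL := left_right (rel_syms phi) (rel_syms psi).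
Let CL := left_right (cst_syms phi) (cst_syms psi).

Let initial : state L X := fun i =>
  if i then [set (phi, id)] else [set (Neg psi, id)].

Lemma initial_vars : state_vars initial = set0.
Proof.
apply/seteqP; split=> // x [[] _ [_ -> [y /=]]].
- by case: sphi => _ ->.
- by case: spsi => _ ->.
Qed.

Lemma initial_separable : separable K RL CL initial.
Proof.
apply: contrapT => ns.
have p0P : inseparable K RL CL initial.
  by split=> //; rewrite initial_vars; exact: finite_set0.
pose p0 : state_forcing X K RL CL := exist _ initial p0P.
have CLc : forall c, exists i, CL i c := left_right_cover _ _.
have lphi : in_lang RL CL true phi by split=> z hz [].
have lpsi : in_lang RL CL false psi by split.
have [h1 _] := truth_lemma X_infinite bool_lt_K CLc sphi.1 lphi p0 id.
have [_ h2] := truth_lemma X_infinite bool_lt_K CLc spsi.1 lpsi p0 id.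
have /h1 v1 : proves true p0 (phi, id) by exact: entails_in.
have /h2 /mem_rcompl /(_ p0 (ext_refl p0)) : proves false p0 (Neg psi, id).
  exact: entails_in.
apply; move: v1.
(* Validity in the generic model puts the value of [phi] below that of [psi], whereas [p0] lies in
   the former and in the complement of the latter. *)
have /Sh_valid_Imp h0 := phi_psi.
have h := h0 _ _ (generic_model X_infinite bool_lt_K RL CLc).
have mM : mixing (generic_model X_infinite bool_lt_K RL CLc).
  exact: generic_mixing.
exact/regular_leP/(h (@regular_complete _) mM).
Qed.

Lemma interpolation_large : exists theta : formula L X,
  [/\ sentence K theta, Sh_valid (Imp phi theta), Sh_valid (Imp theta psi),
      (rel_syms theta `<=` rel_syms phi `&` rel_syms psi)%classic
    & (cst_syms theta `<=` cst_syms phi `&` cst_syms psi)%classic].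
Proof.
(* The initial state has no variables, so [separates_vars] makes the separating formula a
   sentence. *)
have [_ /separates_vars[theta [kt lt t1 t2]]] := initial_separable.
rewrite initial_vars => tv; exists theta; split.
- by split=> //; apply/seteqP; split.
- apply/Sh_valid_Imp => d B M cB mM e.
  by apply: (t1 d B M cB mM e) => _ ->.
- apply/Sh_valid_Imp => d B M cB mM e; rewrite -leC.
  by apply: (t2 d B M cB mM e) => _ ->.
- by apply: left_right_meet => i; have [] := lt i.
- by apply: left_right_meet => i; have [] := lt i.
Qed.

End LargeCardinal.

(** * Reinterpretation of constants and of one relation symbol *)

Section Reinterpretation.
Local Open Scope order_scope.
Variables (L : signature) (X : choiceType).
Variables (d : Order.disp_t) (B : ctbDistrLatticeType d) (M : bvmodel L B).
Implicit Types (chi : formula L X) (e : X -> M).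

(** Carrier and equality stay the same, so a proof of [mixing M] is by conversion also one for the
    new model. The same holds for [with_const_rel]. *)
Definition with_csts (k : cstsym L -> M) : bvmodel L B :=
  @BVModel L d B M (@eqv _ _ _ M) (relv M) k (bv_nonempty M)
    (@eqv_refl _ _ _ M) (@eqv_sym _ _ _ M) (@eqv_trans _ _ _ M)
    (@relv_congr _ _ _ M).

Lemma value_with_csts k chi e :
  (forall c, cst_syms chi c -> k c = cstv M c) ->
  @value L X d B (with_csts k) chi e = value chi e.
Proof.
have tk t : (forall c, term_csts t c -> k c = cstv M c) -> forall e : X -> M,
    @term_value L X d B (with_csts k) t e = term_value t e.
  by case: t => //= c h e'; exact: h.
elim: chi e => [s t|r t|phi IH|I Phi IH|I Phi IH|V phi IH|V phi IH] e h /=.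
- rewrite !tk// => c hc; apply: h; first by right.
  by left.
- congr (relv M r _); apply/funext => i; apply: tk => c hc.
  by apply: h; exists i.
- by rewrite IH.
- apply: (congr1 (@Inf d B)); apply: eq_imagel => i _; apply: IH => c hc.
  by apply: h; exists i.
- apply: (congr1 (@Sup d B)); apply: eq_imagel => i _; apply: IH => c hc.
  by apply: h; exists i.
- by apply: (congr1 (@Inf d B)); apply: eq_imagel => e' _; exact: IH.
- by apply: (congr1 (@Sup d B)); apply: eq_imagel => e' _; exact: IH.
Qed.

Variable r : relsym L.

Definition const_relv (v : B) (r' : relsym L) (t : 'I_(arity r') -> M) : B :=
  if pselect (r' = r) then v else relv M r' t.

Lemma const_relv_congr v (r' : relsym L) (s t : 'I_(arity r') -> M) :
  (\meet_(i < arity r') eqv (s i) (t i)) `&` const_relv v s <= const_relv v t.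
Proof.
by rewrite /const_relv; case: pselect => h /=; [exact: leIr|exact: relv_congr].
Qed.

Definition with_const_rel (v : B) : bvmodel L B :=
  @BVModel L d B M (@eqv _ _ _ M) (const_relv v) (cstv M) (bv_nonempty M)
    (@eqv_refl _ _ _ M) (@eqv_sym _ _ _ M) (@eqv_trans _ _ _ M)
    (@const_relv_congr v).

Lemma value_with_const_rel v chi e : ~ rel_syms chi r ->
  @value L X d B (with_const_rel v) chi e = value chi e.
Proof.
have tk t : forall e : X -> M,
    @term_value L X d B (with_const_rel v) t e = term_value t e by case: t.
elim: chi e => [s t|r' t|phi IH|I Phi IH|I Phi IH|V phi IH|V phi IH] e h /=.
- by rewrite !tk.
- rewrite /const_relv; case: pselect => [r'r|hr] /=.
    by case: h; exact/esym.
  by congr (relv M r' _); apply/funext => i; exact: tk.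
- by rewrite IH.
- apply: (congr1 (@Inf d B)); apply: eq_imagel => i _; apply: IH => hr.
  by apply: h; exists i.
- apply: (congr1 (@Sup d B)); apply: eq_imagel => i _; apply: IH => hr.
  by apply: h; exists i.
- by apply: (congr1 (@Inf d B)); apply: eq_imagel => e' _; exact: IH.
- by apply: (congr1 (@Sup d B)); apply: eq_imagel => e' _; exact: IH.
Qed.

End Reinterpretation.

(** * Substitution of terms for constants *)

Section ConstantSubstitution.
Local Open Scope order_scope.
Variables (L : signature) (X : choiceType) (rho : cstsym L -> term L X).
Implicit Types (chi : formula L X).

Definition subst_term (t : term L X) : term L X :=
  if t is Cst c then rho c else t.

Fixpoint subst_csts chi : formula L X :=
  match chi with
  | Eq s t => Eq (subst_term s) (subst_term t)
  | Rel r t => Rel r (fun i => subst_term (t i))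
  | Neg phi => Neg (subst_csts phi)
  | Conj _ Phi => Conj (fun i => subst_csts (Phi i))
  | Disj _ Phi => Disj (fun i => subst_csts (Phi i))
  | All V phi => All V (subst_csts phi)
  | Ex V phi => Ex V (subst_csts phi)
  end.

Fixpoint bound_vars (chi : formula L X) : set X :=
  match chi with
  | Eq _ _ | Rel _ _ => set0
  | Neg phi => bound_vars phi
  | Conj _ Phi | Disj _ Phi => \bigcup_i bound_vars (Phi i)
  | All V phi | Ex V phi => ([set` V] `|` bound_vars phi)%classic
  end.

Definition rho_vars (C : set (cstsym L)) : set X :=
  \bigcup_(c in C) term_vars (rho c).

(** No substituted variable is bound in [chi], so there is no capture: a reassignment at a
    quantifier leaves the values of all [rho c] unchanged. *)
Lemma value_subst_csts d (B : ctbDistrLatticeType d) (M : bvmodel L B)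
    (k : cstsym L -> M) chi (e : X -> M) :
  (forall c x, term_vars (rho c) x -> ~ bound_vars chi x) ->
  (forall c, term_value (rho c) e = k c) ->
  value (subst_csts chi) e = @value L X d B (with_csts k) chi e.
Proof.
have tk t (e' : X -> M) : (forall c, term_value (rho c) e' = k c) ->
  term_value (subst_term t) e' = @term_value L X d B (with_csts k) t e'.
  by case: t => //= c; apply.
elim: chi e => [s t|r t|phi IH|I Phi IH|I Phi IH|V phi IH|V phi IH]
  e hb he /=.
- by rewrite !tk.
- by congr (relv M r _); apply/funext => i; exact: tk.
- by rewrite IH.
- apply: (congr1 (@Inf d B)); apply: eq_imagel => i _.
  apply: IH => // c x cx bx.
  by apply: (hb c x cx); exists i.
- apply: (congr1 (@Sup d B)); apply: eq_imagel => i _.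
  apply: IH => // c x cx bx.
  by apply: (hb c x cx); exists i.
- apply: (congr1 (@Inf d B)); apply: eq_imagel => e' re.
  apply: IH => [c x cx bx|c].
    by apply: (hb c x cx); right.
  rewrite -he; apply: term_value_ext => x cx; apply: re.
  by apply/negP => xV; apply: (hb c x cx); left.
- apply: (congr1 (@Sup d B)); apply: eq_imagel => e' re.
  apply: IH => [c x cx bx|c].
    by apply: (hb c x cx); right.
  rewrite -he; apply: term_value_ext => x cx; apply: re.
  by apply/negP => xV; apply: (hb c x cx); left.
Qed.

Lemma rel_syms_subst_csts chi : rel_syms (subst_csts chi) = rel_syms chi.
Proof.
elim: chi => [s t|r t|phi IH|I Phi IH|I Phi IH|V phi IH|V phi IH] //=.
- by apply: eq_bigcupr => i _; exact: IH.
- by apply: eq_bigcupr => i _; exact: IH.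
Qed.

Lemma cst_syms_subst_csts chi :
  cst_syms (subst_csts chi) `<=` \bigcup_(c in cst_syms chi) term_csts (rho c).
Proof.
have tk t : term_csts (subst_term t) `<=`
    \bigcup_(c in term_csts t) term_csts (rho c).
  by case: t => [x|c] c' //= hc; exists c.
elim: chi => [s t|r t|phi IH|I Phi IH|I Phi IH|V phi IH|V phi IH] //=.
- by move=> c' [] /tk[c hc cc']; exists c => //; [left|right].
- by move=> c' [i _ /tk[c hc cc']]; exists c => //; exists i.
- by move=> c' [i _ /IH[c hc cc']]; exists c => //; exists i.
- by move=> c' [i _ /IH[c hc cc']]; exists c => //; exists i.
Qed.

Lemma free_vars_subst_csts chi :
  (free_vars (subst_csts chi) `<=`
   free_vars chi `|` rho_vars (cst_syms chi))%classic.
Proof.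
have tk t : (term_vars (subst_term t) `<=`
    term_vars t `|` rho_vars (term_csts t))%classic.
  by case: t => [x|c] x' /= hx; [left|right; exists c].
elim: chi => [s t|r t|phi IH|I Phi IH|I Phi IH|V phi IH|V phi IH] //=.
- move=> x' [] /tk[hx|[c hc cx]].
  + by left; left.
  + by right; exists c => //; left.
  + by left; right.
  + by right; exists c => //; right.
- move=> x' [i _ /tk[hx|[c hc cx]]]; first by left; exists i.
  by right; exists c => //; exists i.
- move=> x' [i _ /IH[hx|[c hc cx]]]; first by left; exists i.
  by right; exists c => //; exists i.
- move=> x' [i _ /IH[hx|[c hc cx]]]; first by left; exists i.
  by right; exists c => //; exists i.
- by move=> x' [/IH[hx|hx] xV]; [left|right].
- by move=> x' [/IH[hx|hx] xV]; [left|right].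
Qed.

End ConstantSubstitution.

(** * Interpolation when [K] has at most two elements *)

Section SmallCardinal.
Local Open Scope order_scope.
Variables (L : signature) (X : choiceType) (K : Type).
Hypothesis X_infinite : infinite_set [set: X].
Hypothesis bool_not_lt_K : ~ card_lt bool K.
Implicit Types (chi : formula L X).

(** Two distinct indices would embed [bool] into [J], and [bool] would then be strictly smaller than
    [K]. *)
Lemma small_index J : card_lt J K -> is_subset1 [set: J].
Proof.
move=> [JK nKJ] i j _ _; apply: contrapT => ij; apply: bool_not_lt_K.
have bJ : [set: bool] #<= [set: J].
  pose f (b : bool) := if b then i else j.
  have f_inj : {in [set: bool] &, injective f}.
    by move=> [] [] _ _ //= ji; case: ij.
  have /card_eqPle[_ h] := inj_card_eq f_inj.
  exact: card_le_trans h (card_leT _).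
split; first exact: card_le_trans bJ JK.
by move=> Kb; apply: nKJ; exact: card_le_trans Kb bJ.
Qed.

Lemma small_finite J T (F : J -> set T) : card_lt J K ->
  (forall j, finite_set (F j)) -> finite_set (\bigcup_j F j).
Proof.
move=> /small_index J1 finF; apply: bigcup_finite => //.
have [[j]|hJ] := pselect (inhabited J); last first.
  rewrite (_ : [set: J] = set0); first exact: finite_set0.
  by apply/seteqP; split=> // j; case: hJ.
rewrite (_ : [set: J] = [set j]); first exact: finite_set1.
by apply/seteqP; split=> // i _; exact: J1.
Qed.

Lemma small_finite_csts chi : Lkw K chi -> finite_set (cst_syms chi).
Proof.
have tk (t : term L X) : finite_set (term_csts t).
  by case: t => [x|c] /=; [exact: finite_set0|exact: finite_set1].
elim: chi => [s t|r t|phi IH|I Phi IH|I Phi IH|V phi IH|V phi IH] //=.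
- by move=> _; rewrite finite_setU; split; exact: tk.
- by move=> _; apply: bigcup_finite => [|i _]; [exact: finite_finset|exact: tk].
- by move=> [ltI _ kI]; apply: small_finite => // i; exact: IH.
- by move=> [ltI _ kI]; apply: small_finite => // i; exact: IH.
Qed.

Lemma small_finite_bound chi : Lkw K chi -> finite_set (bound_vars chi).
Proof.
elim: chi => [s t|r t|phi IH|I Phi IH|I Phi IH|V phi IH|V phi IH] //=.
- by move=> [ltI _ kI]; apply: small_finite => // i; exact: IH.
- by move=> [ltI _ kI]; apply: small_finite => // i; exact: IH.
- by move=> /IH h; rewrite finite_setU; split=> //; exact: finite_fset.
- by move=> /IH h; rewrite finite_setU; split=> //; exact: finite_fset.
Qed.

(** Substitution may bring in new variables, but a conjunction or disjunction has at most one member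
    here, so joint finiteness survives. *)
Lemma Lkw_subst_csts rho chi : Lkw K chi -> Lkw K (subst_csts rho chi).
Proof.
elim: chi => [s t|r t|phi IH|I Phi IH|I Phi IH|V phi IH|V phi IH] //=.
- move=> [ltI _ kI]; split=> // [|i]; last exact: IH.
  by apply: small_finite => // i; apply: (@Lkw_finite _ _ K); exact: IH.
- move=> [ltI _ kI]; split=> // [|i]; last exact: IH.
  by apply: small_finite => // i; apply: (@Lkw_finite _ _ K); exact: IH.
Qed.

(* A formula with at most unary conjunctions and disjunctions is a prefix of
   negations and quantifiers followed by an atom. *)
Lemma small_value_const_rel chi r : Lkw K chi -> rel_syms chi r ->
  exists sgn : bool, forall d (B : ctbDistrLatticeType d) (M : bvmodel L B)
    (v : B) (e : X -> M), complete_lattice B ->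
    @value L X d B (with_const_rel M r v) chi e = if sgn then v else ~` v.
Proof.
have S1 d (B : ctbDistrLatticeType d) (v : B) (T : Type) (A : set T)
    (F : T -> B) :
    complete_lattice B -> A !=set0 -> (forall t, F t = v) -> Sup (F @` A) = v.
  move=> cB [t At] Fv; apply/eqP; rewrite eq_le; apply/andP; split.
    by apply: Sup_le => // _ [s _ <-]; rewrite Fv.
  by apply: le_Sup => //; exists t.
have I1 d (B : ctbDistrLatticeType d) (v : B) (T : Type) (A : set T)
    (F : T -> B) :
    complete_lattice B -> A !=set0 -> (forall t, F t = v) -> Inf (F @` A) = v.
  move=> cB [t At] Fv; apply/eqP; rewrite eq_le; apply/andP; split.
    by apply: Inf_le => //; exists t.
  by apply: le_Inf => // _ [s _ <-]; rewrite Fv.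
elim: chi => [s t|r' t|phi IH|I Phi IH|I Phi IH|V phi IH|V phi IH] //=.
- move=> _ ->; exists true => d B M v e cB.
  by rewrite /const_relv; case: pselect => h.
- move=> /IH h /h[sgn hs]; exists (~~ sgn) => d B M v e cB.
  by rewrite hs//; case: sgn {hs}; rewrite //= complK.
- move=> [ltI _ kI] [i _ /(IH i (kI i))[sgn hs]]; exists sgn => d B M v e cB.
  apply: I1 => //; first by exists i.
  move=> j; have -> : j = i by exact: (small_index ltI).
  by rewrite hs.
- move=> [ltI _ kI] [i _ /(IH i (kI i))[sgn hs]]; exists sgn => d B M v e cB.
  apply: S1 => //; first by exists i.
  move=> j; have -> : j = i by exact: (small_index ltI).
  by rewrite hs.
- move=> /IH h /h[sgn hs]; exists sgn => d B M v e cB.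
  by apply: I1 => // [|e']; [exists e|exact: hs].
- move=> /IH h /h[sgn hs]; exists sgn => d B M v e cB.
  by apply: S1 => // [|e']; [exists e|exact: hs].
Qed.

Variables phi psi : formula L X.
Hypotheses (sphi : sentence K phi) (spsi : sentence K psi).
Hypothesis phi_psi : Sh_valid (Imp phi psi).

Lemma small_valid r : rel_syms phi r -> ~ rel_syms psi r -> Sh_valid psi.
Proof.
move=> rphi rpsi d B M cB mM e; apply/eqP; rewrite -le1x.
have [sgn hs] := small_value_const_rel sphi.1 rphi.
(* With this constant value for [r] the sentence [phi] takes the value [\top], while [psi] keeps its
   value in [M]. *)
pose v : B := if sgn then \top else \bot.
rewrite -(value_with_const_rel v e rpsi).
have /Sh_valid_Imp /(_ d B (with_const_rel M r v) cB mM e) := phi_psi.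
rewrite hs// (_ : (if sgn then v else ~` v) = \top)//.
by rewrite /v; case: sgn {hs v} => //; rewrite compl0.
Qed.

Lemma interpolation_small : exists theta : formula L X,
  [/\ sentence K theta, Sh_valid (Imp phi theta), Sh_valid (Imp theta psi),
      (rel_syms theta `<=` rel_syms phi `&` rel_syms psi)%classic
    & (cst_syms theta `<=` cst_syms phi `&` cst_syms psi)%classic].
Proof.
have [[r rphi rpsi]|relS] :=
  pselect (exists2 r, rel_syms phi r & ~ rel_syms psi r).
  have [x _] := infinite_setN0 X_infinite.
  (* Since [psi] is valid here, any valid sentence without non-logical symbols is an interpolant. *)
  exists (All [fset x]%fset (Eq (Var x) (Var x))); split.
  - split=> //; apply/seteqP; split=> // y /= [].
    by case=> -> [] /=; rewrite inE.
  - apply/Sh_valid_Imp => d B M cB mM e; apply: le_Inf => // _ [e' _ <-] /=.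
    by rewrite eqv_refl lex1.
  - apply/Sh_valid_Imp => d B M cB mM e.
    by rewrite (small_valid rphi rpsi cB mM) lex1.
  - by move=> r' [].
  - by move=> c /= [].
pose D := (cst_syms phi `\` cst_syms psi)%classic.
have finD : finite_set D by apply: finite_setD; exact: small_finite_csts sphi.1.
(* Each constant of [phi] foreign to [psi] gets its own variable, chosen off the bound variables of
   [phi] to prevent capture. *)
have [y y_inj y_fresh] :=
  fresh_renaming X_infinite (small_finite_bound sphi.1) finD.
pose rho c : term L X := if pselect (D c) then Var (y c) else Cst c.
have rhoD c : D c -> rho c = Var (y c) by rewrite /rho; case: pselect.
have rhoND c : ~ D c -> rho c = Cst c by rewrite /rho; case: pselect.
have rho_bound c x : term_vars (rho c) x -> ~ bound_vars phi x.
  by rewrite /rho; case: pselect => // Dc /= ->; exact: y_fresh.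
have /finite_fsetP[Z ZE] : finite_set (y @` D) by exact: finite_image.
have ZP z : (z \in Z) = (y @` D) z :> Prop by rewrite ZE.
have ysD c : D c -> y c \in Z by move=> Dc; rewrite ZP; exists c.
exists (Ex Z (subst_csts rho phi)); split.
- split; first exact: Lkw_subst_csts sphi.1.
  apply/seteqP; split=> // x /= [/free_vars_subst_csts[|[c hc]]].
    by rewrite sphi.2.
  rewrite /rho; case: pselect => // Dc /= -> [].
  exact: ysD.
- apply/Sh_valid_Imp => d B M cB mM e.
  (* The constants themselves are the witnesses: [e'] sends [y c] to the interpretation of [c]. *)
  have [e' he' e'y] : exists2 e' : X -> M, reassign Z e e' &
      forall c, term_value (rho c) e' = cstv M c.
    have /choice[g gP] : forall z, exists m : M,
        (forall c, D c -> y c = z -> m = cstv M c) /\ (z \notin Z -> m = e z).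
      move=> z; have [zZ|zZ] := boolP (z \in Z).
        have : (y @` D) z by rewrite -ZP.
        case=> c Dc <-; exists (cstv M c); split=> // c' Dc' yy.
        by rewrite (y_inj c' c)// inE.
      exists (e z); split=> // c Dc yz.
      by case/negP: zZ; rewrite -yz; exact: ysD.
    exists g => [z zZ|c]; first by have [_] := gP z; apply.
    have [Dc|nDc] := pselect (D c); last by rewrite rhoND.
    by rewrite rhoD//=; have [/(_ c Dc erefl)] := gP (y c).
  have -> : value phi e = value (subst_csts rho phi) e'.
    rewrite (value_subst_csts rho_bound e'y) value_with_csts//.
    by apply: value_ext => x; rewrite sphi.2.
  by apply: le_Sup => //; exists e'.
- apply/Sh_valid_Imp => d B M cB mM e; apply: Sup_le => // _ [e' he' <-].
  (* The witnesses serve as new interpretations of the foreign constants. This makes the matrix the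
     value of [phi] in a model where [psi] has its old value, and the assumed implication is applied
     there. *)
  pose k c := term_value (rho c) e'.
  rewrite -[X in X <= _]/(value (subst_csts rho phi) e').
  rewrite (value_subst_csts (k := k) rho_bound)//.
  have -> : value psi e = @value L X d B (with_csts k) psi e'.
    rewrite value_with_csts; first by apply: value_ext => x; rewrite spsi.2.
    by move=> c cpsi; rewrite /k rhoND// => -[].
  have /Sh_valid_Imp := phi_psi; exact.
- rewrite /= rel_syms_subst_csts => r rphi; split=> //.
  by apply: contrapT => rpsi; apply: relS; exists r.
- move=> c' /cst_syms_subst_csts[c cphi].
  rewrite /rho; case: pselect => // nD /= ->.
  by split=> //; apply: contrapT => cpsi; apply: nD; split.
Qed.

End SmallCardinal.

Theorem theorem3p2 (L : signature) (X : choiceType)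
    (X_infinite : infinite_set [set: X]) (K : Type) (phi psi : formula L X) :
  sentence K phi -> sentence K psi -> Sh_valid (Imp phi psi) ->
  exists theta : formula L X,
    [/\ sentence K theta,
        Sh_valid (Imp phi theta),
        Sh_valid (Imp theta psi),
        rel_syms theta `<=` rel_syms phi `&` rel_syms psi
      & cst_syms theta `<=` cst_syms phi `&` cst_syms psi].
Proof.
move=> sphi spsi h; have [hK|hK] := pselect (card_lt bool K).
  exact: (interpolation_large X_infinite hK).
exact: (interpolation_small X_infinite hK).
Qed.
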